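(* There is an absolute constant $c_0$ such that for every $2<q<\infty$, every $n\in\mathbb N$ and every $n$-dimensional Banach space $E$ there is $m\in\mathbb N$ with $$m\le n\,\big(c_0(1+\ln n)\big)^{\frac{1}{1-\frac2q}}$$ such that the Rademacher cotype $q$ constant of $E$ satisfies $$C_q(\mathrm{Id}_E)\le 2\,C_q^m(\mathrm{Id}_E).$$
   Context: For $2\le q<\infty$, a bounded linear operator $T:X\to Y$ between Banach spaces and $m\in\mathbb N$, the Rademacher cotype $q$ norm of $T$ with respect to $m$ vectors is $$C_q^m(T)=\sup\Big\{\Big(\sum_{k=1}^m\|Tx_k\|^q\Big)^{1/q}\ :\ x_1,\dots,x_m\in X,\ \Big(\int_\Omega\Big\|\sum_{k=1}^m\varepsilon_kx_k\Big\|^2d\mu\Big)^{1/2}\le1\Big\},$$ where $(\varepsilon_k)_{k=1}^m$ are independent Bernoulli variables (taking values $\pm1$ with probability $1/2$ each) on a probability space $(\Omega,\mu)$. The Rademacher cotype $q$ norm is $C_q(T)=\sup_mC_q^m(T)$. $\mathrm{Id}_E$ is the identity operator on $E$. *)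

(* Defs.v *)
From HB Require Import structures.
From mathcomp Require Import all_boot all_order all_algebra.
From mathcomp Require Import complex.
From mathcomp Require Import all_classical all_reals all_analysis.

Set Implicit Arguments.
Unset Strict Implicit.
Unset Printing Implicit Defensive.

Import Order.TTheory GRing.Theory Num.Theory.
Import numFieldNormedType.Exports.

Local Open Scope classical_set_scope.
Local Open Scope ring_scope.

(* Banach spaces are over the reals or the complexes. A normedModType over K
   has a K-valued norm and K-scalars, so real scalars have to be injected into
   K ([to_scalar]) and norms read back in R ([of_scalar]). *)
Variant scalar_kind := RealScalars | ComplexScalars.

Definition scalar_field (R : realType) (s : scalar_kind) : numFieldType :=
  match s with RealScalars => R | ComplexScalars => R[i] end.

Definition to_scalar (R : realType) (s : scalar_kind) :
    R -> scalar_field R s :=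
  match s with
  | RealScalars => fun x => x
  | ComplexScalars => fun x => Complex x 0
  end.

Definition of_scalar (R : realType) (s : scalar_kind) :
    scalar_field R s -> R :=
  match s with
  | RealScalars => fun x => x
  | ComplexScalars => fun z => complex.Re z
  end.

Definition rnorm (R : realType) (s : scalar_kind)
  (E : normedModType (scalar_field R s)) (x : E) : R := of_scalar `|x|.

Definition independent_seq (d : measure_display) (Omega : measurableType d)
    (R : realType) (mu : probability Omega R) (X : nat -> {RV mu >-> R}) :=
  forall (J : seq nat) (A : nat -> set R), uniq J ->
    (forall j, measurable (A j)) ->
    mu (\bigcap_(j in [set` J]) (X j @^-1` A j)) =
    (\prod_(j <- J) mu (X j @^-1` A j))%E.

Definition bernoulli_seq (d : measure_display) (Omega : measurableType d)
    (R : realType) (mu : probability Omega R) (eps : nat -> {RV mu >-> R}) :=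
  independent_seq eps /\
  forall k, mu (eps k @^-1` [set 1]) = (2^-1)%:E /\
            mu (eps k @^-1` [set -1]) = (2^-1)%:E.

(* Meaningful when eps is a Bernoulli sequence (the value then depends on
   neither eps nor mu) and T is bounded. The vectors x_1, ..., x_m are indexed
   from 0. *)
Definition cotype_norm_on (R : realType) (s : scalar_kind)
    (d : measure_display) (Omega : measurableType d)
    (mu : probability Omega R) (eps : nat -> {RV mu >-> R})
    (X Y : normedModType (scalar_field R s)) (T : {linear X -> Y})
    (q : R) (m : nat) : \bar R :=
  ereal_sup
    [set ((\sum_(k < m) rnorm (T (x k)) `^ q) `^ q^-1)%:E | x in
      [set x : 'I_m -> X |
        ((\int[mu]_w
            ((rnorm (\sum_(k < m) to_scalar s (eps k w) *: x k)) ^+ 2)%:E)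
          `^ 2^-1 <= 1)%E]].

Definition cotype_norm (R : realType) (s : scalar_kind)
    (d : measure_display) (Omega : measurableType d)
    (mu : probability Omega R) (eps : nat -> {RV mu >-> R})
    (X Y : normedModType (scalar_field R s)) (T : {linear X -> Y})
    (q : R) : \bar R :=
  ereal_sup (range (cotype_norm_on eps T q)).

(* Main.v *)
Require Import Defs.
From HB Require Import structures.
From mathcomp Require Import all_boot all_order all_algebra.
From mathcomp Require Import complex ring lra.
From mathcomp Require Import all_classical all_reals all_analysis.
From mathcomp Require Import measurable_realfun.

Set Implicit Arguments.
Unset Strict Implicit.
Unset Printing Implicit Defensive.

Import Order.TTheory GRing.Theory Num.Theory.
Import numFieldNormedType.Exports.

Local Open Scope classical_set_scope.
Local Open Scope ring_scope.

(* Let [K] be the cotype constant on [m] vectors and let [x_1, ..., x_N] have Rademacher mean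
   at most one. At most [m] of the [x_k] have norm larger than [t = K m^(-1/q)], so these
   contribute at most [K^q]; the others contribute at most [t^(q-2)] times the sum of the
   [|x_k|^2]. It remains to bound the latter by [C (1 + ln n) n^(1-2/q) K^2], that is, to pass
   from [N] vectors to [d <= 2n] vectors [y_j] with comparable sum of squares and a Rademacher
   second moment larger by a factor [O(1 + ln n)] only, [d] being the real dimension.
   In coordinates where the [x_k] form a tight frame, the [y_j] are multiples of some of the
   [x_k], selected by the one-sided barrier method of Batson, Spielman and Srivastava so that
   the covariance of the [y_j] is dominated by that of the [x_k]. Gaussian means are monotone in
   the covariance, and they dominate Rademacher means. Conversely, the Gaussian mean of the
   [x_k] is compared with the Rademacher one by clipping the Gaussian coefficients at a level
   of order [sqrt (1 + ln d)]: the clipped part is handled by the contraction principle, and the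
   tail by the bound [|sum a_k x_k|^2 <= (sum a_k^2) E |sum eps_k x_k|^2]. *)

(** * Lebesgue measure and one-dimensional Gaussian means *)

(** Rademacher means are not monotone in the covariance, which forces the detour through Gaussian
    ones. The way back to signs costs the logarithm: clipping at level [T] leaves a tail of order d
    exp(-T^2/4), to be made bounded. In the final estimate this logarithm is multiplied by
    (d/m)^(1-2/q), whence the exponent 1/(1-2/q) in the bound on [m]. The large vectors contribute
    K^q, the small ones at most 3 K^q, and 4 K^q <= (2K)^q because q > 2; this is the factor 2 of
    the theorem. No Gaussian measure on a vector space is built: a Gaussian mean is a composition of
    one-dimensional averaging operators [heat x], and rotation invariance is needed for two
    consecutive operators only. Covariances are compared through their values on linear functionals.
    The Banach space enters through a seminorm on real row vectors, the norm pulled back along a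
    surjective real-linear map, so that real and complex scalars are treated together. *)

Section lebesgue_invariance.
Context {R : realType}.
Notation mu := (@lebesgue_measure R).
Local Open Scope ereal_scope.

Lemma lebesgue_measure_shift (a : R) (A : set R) : measurable A ->
  pushforward mu (fun x : measurableTypeR R => (x + a)%R : measurableTypeR R) A = mu A.
Proof.
move=> mA; have mf : measurable_fun setT (fun x : measurableTypeR R => (x + a)%R :
  measurableTypeR R).
  exact: measurable_funD.
apply/esym/lebesgue_measure_unique => //= _ [[b c]] _ <-.
rewrite /pushforward.
have -> : (fun x : R => (x + a)%R) @^-1` [set` `]b, c]] = [set` `](b - a)%R, (c - a)%R]].
  by apply/seteqP; split => x /=; rewrite !in_itv/= ltrBlDr lerBrDr.
rewrite !lebesgue_measure_itv/= !lte_fin ltrD2r; case: ifP => // _.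
by rewrite -!EFinB; congr (_%:E); ring.
Qed.

Lemma ge0_integral_shift (f : R -> \bar R) (a : R) :
  measurable_fun setT f -> (forall x, 0 <= f x) ->
  \int[mu]_x f (x + a)%R = \int[mu]_x f x.
Proof.
move=> mf f0.
have mphi : measurable_fun setT (fun x : measurableTypeR R => (x + a)%R : measurableTypeR R).
  exact: measurable_funD.
have := @ge0_integral_pushforward _ _ _ _ R _ mphi mu setT f measurableT mf (fun y _ => f0 y).
rewrite preimage_setT => <-.
by apply: eq_measure_integral => //= A mA _; exact: lebesgue_measure_shift.
Qed.

Lemma ge0_integral_opp (f : R -> \bar R) :
  measurable_fun setT f -> (forall x, 0 <= f x) ->
  \int[mu]_x f (- x)%R = \int[mu]_x f x.
Proof.
move=> mf f0.
have mphi : measurable_fun setT (fun x : measurableTypeR R => (- x)%R : measurableTypeR R).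
  exact: oppr_measurable.
have := @ge0_integral_pushforward _ _ _ _ R _ mphi mu setT f measurableT mf (fun y _ => f0 y).
rewrite preimage_setT => <-.
by apply: eq_measure_integral => //= A mA _; exact: lebesgue_measureN.
Qed.

End lebesgue_invariance.

(** Rounding [s] down to the grid of step 1/(n+1) makes the function measurable on each of countably
    many strips, and continuity in [s] gives the pointwise limit. It provides joint measurability
    where the vectors live in a space without topology or sigma-algebra. *)
Lemma caratheodory_measurable (R : realType) (d : measure_display)
  (S : measurableType d) (F : R -> S -> R) :
  (forall t, continuous (F ^~ t)) -> (forall s, measurable_fun setT (F s)) ->
  measurable_fun setT (fun st : R * S => F st.1 st.2).
Proof.
move=> cF mF.
pose r (n : nat) (s : R) : R := (Num.floor (s * n.+1%:R))%:~R / n.+1%:R.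
apply: (@measurable_fun_cvg _ _ _ _ (fun n (st : R * S) => F (r n st.1) st.2)); last first.
  move=> [s t] _ /=.
  suff rs : r ^~ s @ \oo --> s.
    exact: (cvg_comp _ _ rs (cF t s)).
  apply/cvgrPdist_le => e e0; near=> n.
  have n0 : (0 : R) < n.+1%:R by rewrite ltr0n.
  have h1 : (Num.floor (s * n.+1%:R))%:~R <= s * n.+1%:R by exact: floor_le.
  have h2 : s * n.+1%:R < (Num.floor (s * n.+1%:R))%:~R + 1.
    by have := floorD1_gt (s * n.+1%:R); rewrite intrD.
  have -> : s - r n s = (s * n.+1%:R - (Num.floor (s * n.+1%:R))%:~R) / n.+1%:R.
    by rewrite /r; field; rewrite lt0r_neq0//.
  rewrite normrM ger0_norm ?subr_ge0// (gtr0_norm (x := _^-1)) ?invr_gt0//.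
  rewrite ler_pdivrMr//.
  apply: (@le_trans _ _ 1); first by rewrite lerBlDl ltW.
  rewrite mulrC -ler_pdivrMr// div1r.
  near: n; exists (Num.Def.trunc e^-1).+1 => // k /= hk.
  have := truncnS_gt e^-1; move=> /ltW /le_trans; apply.
  by rewrite ler_nat ltnW.
move=> n.
(* The strips are numbered through [pickle] so that the union runs over [nat]; a number that codes
   no integer gives an empty strip. *)
pose I (k : nat) : set R := [set s | pickle (Num.floor (s * n.+1%:R)) = k].
have mI k : measurable (I k).
  case: (pselect (exists s, I k s)) => [[s0 s0k]|hn]; last first.
    by rewrite (_ : I k = set0)//; apply/seteqP; split => // s hs; case: hn; exists s.
  pose c := Num.floor (s0 * n.+1%:R).
  suff -> : I k = `[c%:~R / n.+1%:R, (c + 1)%:~R / n.+1%:R[%classic by exact: measurable_itv.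
  have n0 : (0 : R) < n.+1%:R by rewrite ltr0n.
  apply/seteqP; split => s /=; rewrite in_itv/= ler_pdivrMr// ltr_pdivlMr//.
    move=> sk; have -> : c = Num.floor (s * n.+1%:R).
      by apply: (pcan_inj pickleK); rewrite s0k -sk.
    by rewrite floor_le floorD1_gt.
  by move=> hs; rewrite /I/= (floor_def hs).
have -> : [set: R * S] = \bigcup_k (I k `*` setT).
  by apply/seteqP; split => // -[s t] _; exists (pickle (Num.floor (s * n.+1%:R))).
apply/measurable_fun_bigcup; first by move=> k; exact: measurableX.
move=> k.
case: (pselect (exists s, I k s)) => [[s0 s0k]|hn]; last first.
  have -> : I k `*` setT = set0 :> set (R * S).
    by apply/seteqP; split => // -[s t] [/= hs _]; case: hn; exists s.
  exact: measurable_fun_set0.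
apply: (@eq_measurable_fun _ _ _ _ _ (fun st : R * S => F (r n s0) st.2)).
  move=> [s t]; rewrite inE => -[/= hs _]; rewrite /r; congr (F (_%:~R / _) _).
  by apply: (pcan_inj pickleK); rewrite hs s0k.
apply: measurable_funTS; apply: measurableT_comp; first exact: mF.
exact: measurable_snd.
Unshelve. all: end_near.
Qed.

Section gauss.
Context {R : realType}.
Notation mu := (@lebesgue_measure R).
Implicit Types (h : R -> R) (a : R).

Definition gauss_pdf : R -> R := normal_pdf 0 1.

Lemma gauss_pdfE t : gauss_pdf t = normal_peak 1 * expR (- (t ^+ 2) / 2).
Proof. by rewrite /gauss_pdf normal_pdfE ?oner_eq0//= /normal_fun subr0 expr1n. Qed.

Lemma gauss_pdf_ge0 t : 0 <= gauss_pdf t. Proof. exact: normal_pdf_ge0. Qed.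

Lemma measurable_gauss_pdf : measurable_fun setT gauss_pdf.
Proof. exact: measurable_normal_pdf. Qed.

Lemma gauss_pdfN t : gauss_pdf (- t) = gauss_pdf t.
Proof. by rewrite !gauss_pdfE sqrrN. Qed.

Lemma gauss_pdf_rot c s x y : c ^+ 2 + s ^+ 2 = 1 ->
  gauss_pdf (c * x - s * y) * gauss_pdf (s * x + c * y) = gauss_pdf x * gauss_pdf y.
Proof.
move=> cs; rewrite !gauss_pdfE mulrACA [RHS]mulrACA; congr (_ * _).
rewrite -!expRD; congr expR.
have -> : - x ^+ 2 / 2 + - y ^+ 2 / 2 = - ((c ^+ 2 + s ^+ 2) * (x ^+ 2 + y ^+ 2)) / 2.
  by rewrite cs; field.
by field.
Qed.

(* The substitution is a product of three shears. *)
Lemma integral_rot (G : R -> R -> \bar R) (c s : R) : c ^+ 2 + s ^+ 2 = 1 -> s != 0 ->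
  measurable_fun setT (fun st : R * R => G st.1 st.2) -> (forall x y, (0 <= G x y)%E) ->
  (\int[mu]_x \int[mu]_y G (c * x - s * y)%R (s * x + c * y)%R =
   \int[mu]_x \int[mu]_y G x y)%E.
Proof.
move=> cs s0 mG G0.
(* Minus the tangent of the half angle: the rotation is a shear by [a] in the first variable, one by
   [s] in the second, and one by [a] in the first again. *)
pose a := (c - 1) / s.
pose sh1 b (H : R -> R -> \bar R) := fun x y => H (x + b * y) y.
pose sh2 b (H : R -> R -> \bar R) := fun x y => H x (y + b * x).
pose J (H : R -> R -> \bar R) := (\int[mu]_x \int[mu]_y H x y)%E.
pose M (H : R -> R -> \bar R) := measurable_fun setT (fun st : R * R => H st.1 st.2) /\
  (forall x y, (0 <= H x y)%E).
have mx H x : M H -> measurable_fun setT (H x).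
  by move=> [mH _]; exact: (measurableT_comp mH (pair1_measurable x)).
have my H y : M H -> measurable_fun setT (H ^~ y).
  by move=> [mH _]; exact: (measurableT_comp mH (pair2_measurable y)).
have M1 b H : M H -> M (sh1 b H).
  move=> [mH H0]; split; last by move=> x y; exact: H0.
  apply: (measurableT_comp mH (g := fun st : R * R => (st.1 + b * st.2, st.2))).
  apply: measurable_fun_pair => /=; last exact: measurable_snd.
  apply: measurable_funD; first exact: measurable_fst.
  by apply: measurable_funM => //; exact: measurable_snd.
have M2 b H : M H -> M (sh2 b H).
  move=> [mH H0]; split; last by move=> x y; exact: H0.
  apply: (measurableT_comp mH (g := fun st : R * R => (st.1, st.2 + b * st.1))).
  apply: measurable_fun_pair => /=; first exact: measurable_fst.
  apply: measurable_funD; first exact: measurable_snd.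
  by apply: measurable_funM => //; exact: measurable_fst.
have J2 b H : M H -> J (sh2 b H) = J H.
  move=> MH; apply: eq_integral => x _; rewrite /sh2.
  by apply: (@ge0_integral_shift _ (H x)); [exact: mx|exact: MH.2].
have J1 b H : M H -> J (sh1 b H) = J H.
  move=> MH; rewrite /J.
  have /= -> := @fubini_tonelli _ _ _ _ _ mu mu (fun st : R * R => H st.1 st.2) MH.1 (fun st =>
    MH.2 _ _).
  have /= -> := @fubini_tonelli _ _ _ _ _ mu mu (fun st : R * R => sh1 b H st.1 st.2) (M1 _ _
    MH).1 (fun st => (M1 _ _ MH).2 _ _).
  apply: eq_integral => y _; rewrite /sh1.
  by apply: (@ge0_integral_shift _ (H ^~ y)); [exact: my|move=> x; exact: MH.2].
have MG : M G by [].
rewrite -[RHS](J1 a)// -(J2 s)//; last exact: M1.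
rewrite -(J1 a); last by apply: M2; exact: M1.
apply: eq_integral => x _; apply: eq_integral => y _.
have c2 : c ^+ 2 = 1 - s ^+ 2 by rewrite -cs addrK.
have e1 : s * a = c - 1 by rewrite /a mulrC divfK.
have e2 : a * (1 + c) = - s.
  apply: (mulfI s0); rewrite mulrA e1; have -> : s * - s = - s ^+ 2 by ring.
  have -> : (c - 1) * (1 + c) = c ^+ 2 - 1 by ring.
  by rewrite c2; ring.
rewrite /sh1 /sh2 /=; congr (G _ _).
  have -> : x + a * y + a * (y + s * (x + a * y)) = x * (1 + s * a) + (a * (1 + (1 + s * a))) * y
    by ring.
  by rewrite e1 (_ : 1 + (c - 1) = c) ?e2; ring.
have -> : y + s * (x + a * y) = s * x + (1 + s * a) * y by ring.
by rewrite e1; ring.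
Qed.

End gauss.

(** * Gaussian means of functions of quadratic growth, and clipped Gaussians *)

Section gauss_expectation.
Context {R : realType}.
Notation mu := (@lebesgue_measure R).
Implicit Types (h : R -> R) (a : R).

Definition gauss_mean h : R := \int[mu]_t (h t * gauss_pdf t).

(** Quadratic growth is what the square of a seminorm has along a line, and it ensures integrability
    against the Gaussian density. *)
Definition tame h := measurable_fun setT h /\
  exists a : R, forall t : R, `|h t| <= a * (1 + t ^+ 2).

(** The Gaussian density of variance 4 decays slower by a factor exp(3t^2/8) >= 1 + 3t^2/8, which
    absorbs the polynomial. It serves as integrable majorant. *)
Lemma gauss_pdf_tail (t : R) : (1 + t ^+ 2) * gauss_pdf t <=
  8 / 3 * (normal_peak 1 / normal_peak 2) * normal_pdf 0 2 t.
Proof.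
have p1 : (0 : R) < normal_peak 1 by apply: normal_peak_gt0; rewrite oner_neq0.
have p2 : (0 : R) < normal_peak 2 by apply: normal_peak_gt0; rewrite pnatr_eq0.
rewrite gauss_pdfE normal_pdfE ?pnatr_eq0//= /normal_fun subr0.
have -> : 8 / 3 * (normal_peak 1 / normal_peak 2) * (normal_peak 2 * expR (- t ^+ 2 / (2 ^+ 2 *+
  2)))
   = normal_peak 1 * (8 / 3 * expR (- t ^+ 2 / (2 ^+ 2 *+ 2))) :> R.
  by field; rewrite lt0r_neq0.
rewrite mulrCA ler_pM2l//.
have -> : expR (- t ^+ 2 / (2 ^+ 2 *+ 2)) = expR (- t ^+ 2 / 2) * expR (3 * t ^+ 2 / 8) :> R.
  by rewrite -expRD; congr expR; rewrite -mulr_natr; field.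
rewrite mulrCA [leLHS]mulrC ler_pM2l ?expR_gt0//.
have := expR_ge1Dx (3 * t ^+ 2 / 8); lra.
Qed.

Lemma integrable_tame h : tame h -> mu.-integrable setT (EFin \o (fun t => h t * gauss_pdf t)).
Proof.
move=> [mh [a ha]].
pose C := 8 / 3 * (normal_peak 1 / normal_peak 2) : R.
have a0 : 0 <= a by have := ha 0; rewrite expr0n/= addr0 mulr1; apply: le_trans.
apply: (@le_integrable _ _ _ mu setT _ _ (EFin \o (fun t => (a * C) * normal_pdf 0 2 t))) => //.
- apply/measurable_EFinP; apply: measurable_funM => //; exact: measurable_gauss_pdf.
- move=> t _ /=; rewrite lee_fin normrM (ger0_norm (gauss_pdf_ge0 _)).
  apply: (@le_trans _ _ (a * ((1 + t ^+ 2) * gauss_pdf t))).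
    by rewrite mulrA; apply: ler_wpM2r; [exact: gauss_pdf_ge0|exact: ha].
  rewrite ger0_norm; first by rewrite -mulrA ler_wpM2l// gauss_pdf_tail.
  rewrite mulr_ge0// ?normal_pdf_ge0// mulr_ge0//.
  by rewrite /C !mulr_ge0// ?invr_ge0// normal_peak_ge0.
- have := @integrableZl _ _ _ mu setT measurableT (a * C) _ (integrable_normal_pdf 0 2).
  by apply: eq_integrable.
Qed.

Lemma tameD h1 h2 : tame h1 -> tame h2 -> tame (fun t => h1 t + h2 t).
Proof.
move=> [m1 [a1 b1]] [m2 [a2 b2]]; split; first exact: measurable_funD.
exists (a1 + a2) => t; rewrite mulrDl; apply: (le_trans (ler_normD _ _)).
exact: lerD.
Qed.

Lemma tameZ (k : R) h : tame h -> tame (fun t => k * h t).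
Proof.
move=> [m1 [a1 b1]]; split; first exact: measurable_funM.
by exists (`|k| * a1) => t; rewrite normrM -mulrA ler_wpM2l.
Qed.

Lemma tame_cst (k : R) : tame (fun=> k).
Proof.
split; first exact: measurable_cst.
by exists `|k| => t; rewrite ler_peMr// lerDl sqr_ge0.
Qed.

Lemma tameN h : tame h -> tame (fun t => h (- t)).
Proof.
move=> [m1 [a1 b1]]; split; last by exists a1 => t; rewrite -(sqrrN t).
by apply: measurableT_comp => //; exact: oppr_measurable.
Qed.

Lemma tame_sqr : tame (fun t : R => t ^+ 2).
Proof.
split; first exact: exprn_measurable.
by exists 1 => t; rewrite mul1r ger0_norm ?sqr_ge0// lerDr.
Qed.

Lemma tame_norm : tame (fun t : R => `|t|).
Proof.
split; first exact: normr_measurable.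
exists 1 => t; rewrite normr_id mul1r -real_normK ?num_real//.
by have := sqr_ge0 (`|t| - 1); have := normr_ge0 t; nra.
Qed.

Lemma gauss_meanD h1 h2 : tame h1 -> tame h2 -> gauss_mean (fun t => h1 t + h2 t) = gauss_mean h1
  + gauss_mean h2.
Proof.
move=> t1 t2; rewrite /gauss_mean; under eq_Rintegral do rewrite mulrDl.
by rewrite RintegralD//; exact: integrable_tame.
Qed.

Lemma gauss_meanZ (k : R) h : tame h -> gauss_mean (fun t => k * h t) = k * gauss_mean h.
Proof.
move=> t1; rewrite /gauss_mean; under eq_Rintegral do rewrite -mulrA.
by rewrite RintegralZl//; exact: integrable_tame.
Qed.

Lemma gauss_mean_cst (k : R) : gauss_mean (fun=> k) = k.
Proof.
rewrite /gauss_mean RintegralZl//; last exact: integrable_normal_pdf.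
by rewrite /Rintegral integral_normal_pdf/= mulr1.
Qed.

Lemma le_gauss_mean h1 h2 : tame h1 -> tame h2 -> (forall t, h1 t <= h2 t) -> gauss_mean h1 <=
  gauss_mean h2.
Proof.
move=> t1 t2 h12; apply: le_Rintegral => //; [exact: integrable_tame..|].
by move=> t _; rewrite ler_wpM2r// gauss_pdf_ge0.
Qed.

Lemma gauss_mean_ge0 h : (forall t, 0 <= h t) -> 0 <= gauss_mean h.
Proof. by move=> h0; apply: Rintegral_ge0 => t _; rewrite mulr_ge0// gauss_pdf_ge0. Qed.

Lemma EFin_gauss_mean h : tame h -> (gauss_mean h)%:E = (\int[mu]_t (h t * gauss_pdf t)%:E)%E.
Proof.
move=> th; rewrite /gauss_mean /Rintegral fineK//.
exact: (@integrable_fin_num _ _ _ mu setT measurableT _ (integrable_tame th)).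
Qed.

Lemma gauss_mean_norm h : tame h -> `|gauss_mean h| <= gauss_mean (fun t => `|h t|).
Proof.
move=> th; apply: (le_trans (le_normr_Rintegral _ _)) => //; first exact: integrable_tame.
rewrite le_eqVlt; apply/orP; left; apply/eqP; apply: eq_Rintegral => t _.
by rewrite normrM (ger0_norm (gauss_pdf_ge0 _)).
Qed.

Lemma gauss_meanN h : tame h -> gauss_mean (fun t => h (- t)) = gauss_mean h.
Proof.
have pos k : tame k -> (forall t, 0 <= k t) -> gauss_mean (fun t => k (- t)) = gauss_mean k.
  move=> tk k0; apply: EFin_inj; rewrite !EFin_gauss_mean//; last exact: tameN.
  transitivity (\int[mu]_t (k (- t) * gauss_pdf (- t))%:E)%E.
    by apply: eq_integral => t _; rewrite gauss_pdfN.
  apply: (@ge0_integral_opp _ (fun t => (k t * gauss_pdf t)%:E)).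
    by apply/measurable_EFinP; apply: measurable_funM; [exact: tk.1|exact: measurable_gauss_pdf].
  by move=> t; rewrite lee_fin mulr_ge0// gauss_pdf_ge0.
move=> th; have [mh [a ha]] := th.
(* The case of nonnegative functions applies after adding an even majorant [w], whose mean then
   cancels. *)
pose w t := a * (1 + t ^+ 2).
have tw : tame w.
  by apply: tameZ; apply: tameD; [exact: tame_cst|exact: tame_sqr].
have h0 t : 0 <= h t + w t.
  by have := ha t; rewrite ler_norml => /andP[]; rewrite -/(w t); lra.
have w0 t : 0 <= w t by apply: le_trans (ha t).
have := pos _ (tameD th tw) h0.
rewrite (@gauss_meanD (fun t => h (- t)) (fun t => w (- t))); [|exact: tameN..].
by rewrite gauss_meanD// (pos w)// => /addIr.
Qed.

Lemma gauss_mean_odd h : tame h -> (forall t, h (- t) = - h t) -> gauss_mean h = 0.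
Proof.
move=> th hN; have := gauss_meanN th.
have -> : (fun t => h (- t)) = (fun t => -1 * h t) by apply/funext => t; rewrite hN mulN1r.
by rewrite gauss_meanZ// => ?; lra.
Qed.

(** A crude substitute for E|g| in the comparison of signs with Gaussians. On this bounded interval
    the density stays above [gauss_pdf 2], which makes positivity immediate. *)
Definition kappa : R := gauss_mean (\1_`[1, 2]).

Lemma tame_indic12 : tame (\1_`[1, 2]).
Proof.
split; first exact: measurable_indic.
exists 1 => t; rewrite mul1r indicE; case: (_ \in _); rewrite ?normr1 ?normr0.
  by rewrite lerDl sqr_ge0.
by rewrite addr_ge0// sqr_ge0.
Qed.

Lemma kappa_le1 : kappa <= 1.
Proof.
rewrite -[leRHS]gauss_mean_cst; apply: le_gauss_mean; [exact: tame_indic12|exact: tame_cst|].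
by move=> t; rewrite indicE; case: (_ \in _).
Qed.

Lemma kappa_gt0 : 0 < kappa.
Proof.
have g2 : (0 : R) < gauss_pdf 2 by rewrite gauss_pdfE mulr_gt0 ?expR_gt0// normal_peak_gt0//
  oner_neq0.
apply: (lt_le_trans g2); rewrite -lee_fin /kappa EFin_gauss_mean; last exact: tame_indic12.
have -> : (gauss_pdf 2)%:E = (\int[mu]_(t in `[1%R, 2%R]) (gauss_pdf 2)%:E)%E.
  rewrite integral_cst//= lebesgue_measure_itv/= lte_fin ltr1n -EFinB.
  by rewrite (_ : 2 - 1 = 1 :> R) ?mule1//; lra.
rewrite integral_mkcond; apply: ge0_le_integral => //.
- by move=> t _; rewrite patchE; case: ifP => // _; rewrite lee_fin gauss_pdf_ge0.
- by apply: (iffLR (measurable_restrictT _ _)) => //; exact: measurable_cst.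
- apply/measurable_EFinP; apply: measurable_funM;
  [exact: tame_indic12.1|exact: measurable_gauss_pdf].
- move=> t _; rewrite patchE indicE; case: ifPn => // [|_]; last by rewrite lee_fin mul0r.
  rewrite inE/= in_itv/= => /andP[t1 t2]; rewrite lee_fin mul1r !gauss_pdfE.
  rewrite ler_pM2l ?normal_peak_gt0// ?oner_neq0// ler_expR ler_pM2r ?invr_gt0//.
  by rewrite lerN2 ler_sqr ?nnegrE//; lra.
Qed.

Definition clip (T t : R) := Num.max (- T) (Num.min T t).

(** The 8 comes from t^2 <= 8 exp(t^2/8), the ratio of peaks from passing to the density of variance
    4. *)
Definition clip_tail_cst : R := 8 * (normal_peak 1 / normal_peak 2).

Lemma clip_tail_cst_ge0 : 0 <= clip_tail_cst.
Proof. by rewrite /clip_tail_cst mulr_ge0// mulr_ge0 ?invr_ge0 ?normal_peak_ge0. Qed.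

Lemma clip_bound T t : 0 <= T -> `|clip T t| <= T.
Proof.
move=> T0; rewrite ler_norml /clip /Num.max /Num.min; apply/andP.
by repeat case: ifPn; rewrite -?leNgt => *; split; lra.
Qed.

Lemma clipN T t : 0 <= T -> clip T (- t) = - clip T t.
Proof.
move=> T0; rewrite /clip /Num.max /Num.min; by repeat case: ifPn; rewrite -?leNgt => *; lra.
Qed.

Lemma clip_eq T t : `|t| <= T -> clip T t = t.
Proof.
by rewrite ler_norml /clip => /andP[h1 h2]; rewrite min_r// max_r.
Qed.

Lemma clip_sub T t : 0 <= T -> `|t - clip T t| <= `|t|.
Proof.
move=> T0; have := ler_norm t; have := ler_norm (- t); rewrite normrN.
rewrite ler_norml /clip /Num.max /Num.min => h1 h2; apply/andP.
by repeat case: ifPn; rewrite -?leNgt => *; split; lra.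
Qed.

Lemma tame_clip T : 0 <= T -> tame (clip T).
Proof.
move=> T0; split.
  by apply: measurable_maxr => //; apply: measurable_minr.
exists T => t; apply: (le_trans (clip_bound t T0)).
by rewrite ler_peMr// lerDl sqr_ge0.
Qed.

Lemma tame_id : tame id.
Proof.
split; first exact: measurable_id.
by have [_ [a ha]] := tame_norm; exists a => t; have := ha t; rewrite normr_id.
Qed.

Lemma tame_clip_sub T : 0 <= T -> tame (fun t => t - clip T t).
Proof.
move=> T0; have := tameD tame_id (tameZ (-1) (tame_clip T0)).
by under [X in tame X -> _]eq_fun do rewrite mulN1r.
Qed.

Lemma tame_clip_sub2 T : 0 <= T -> tame (fun t => (t - clip T t) ^+ 2).
Proof.
move=> T0; split; first by apply: measurable_funX; exact: (tame_clip_sub T0).1.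
exists 1 => t; rewrite mul1r ger0_norm ?sqr_ge0// -real_normK ?num_real//.
rewrite -(real_normK (num_real t)).
by have := clip_sub t T0; have := normr_ge0 (t - clip T t); nra.
Qed.

(** The integrand vanishes for |t| <= T. Beyond, t^2 exp(-t^2/2) <= 8 exp(-3t^2/8), and the exponent
    is split as -t^2/4 - t^2/8: the first part is at most -T^2/4, the second is a Gaussian of
    variance 4. *)
Lemma gauss_mean_tail T : 0 <= T -> gauss_mean (fun t => (t - clip T t) ^+ 2) <= clip_tail_cst *
  expR (- T ^+ 2 / 4).
Proof.
move=> T0; rewrite -lee_fin EFin_gauss_mean; last exact: tame_clip_sub2.
have -> : (clip_tail_cst * expR (- T ^+ 2 / 4))%:E =
   (\int[mu]_t (clip_tail_cst * expR (- T ^+ 2 / 4) * normal_pdf 0 2 t)%:E)%E.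
  under [RHS]eq_integral do rewrite EFinM.
  rewrite integralZl//; last exact: integrable_normal_pdf.
  by rewrite integral_normal_pdf mule1.
have p2 : (0 : R) < normal_peak 2 by apply: normal_peak_gt0; rewrite pnatr_eq0.
apply: ge0_le_integral => //.
- by move=> t _; rewrite lee_fin mulr_ge0 ?sqr_ge0 ?gauss_pdf_ge0.
- apply/measurable_EFinP; apply: measurable_funM;
  [exact: (tame_clip_sub2 T0).1|exact: measurable_gauss_pdf].
- apply/measurable_EFinP; apply: measurable_funM => //; exact: measurable_normal_pdf.
move=> t _; rewrite lee_fin.
case: (lerP `|t| T) => tT.
  by rewrite clip_eq// subrr expr0n mul0r mulr_ge0 ?normal_pdf_ge0// mulr_ge0 ?expR_ge0
    ?clip_tail_cst_ge0.
rewrite gauss_pdfE normal_pdfE ?pnatr_eq0//= /normal_fun subr0 /clip_tail_cst.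
have -> : 8 * (normal_peak 1 / normal_peak 2) * expR (- T ^+ 2 / 4) *
  (normal_peak 2 * expR (- t ^+ 2 / (2 ^+ 2 *+ 2))) =
  normal_peak 1 * (8 * (expR (- T ^+ 2 / 4) * expR (- t ^+ 2 / (2 ^+ 2 *+ 2)))) :> R.
  by field; rewrite lt0r_neq0.
rewrite mulrCA ler_wpM2l ?normal_peak_ge0//.
have t2 : (t - clip T t) ^+ 2 <= t ^+ 2.
  rewrite -real_normK ?num_real// -(real_normK (num_real t)).
  by have := clip_sub t T0; have := normr_ge0 (t - clip T t); nra.
have t8 : t ^+ 2 <= 8 * expR (t ^+ 2 / 8).
  by have := expR_ge1Dx (t ^+ 2 / 8); lra.
apply: (@le_trans _ _ (8 * expR (t ^+ 2 / 8) * expR (- t ^+ 2 / 2))).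
  by rewrite ler_wpM2r ?expR_ge0//; apply: le_trans t8.
rewrite -mulrA -!expRD ler_pM2l// ler_expR.
have : T ^+ 2 <= t ^+ 2 by rewrite -(real_normK (num_real t)); nra.
have -> : 2 ^+ 2 *+ 2 = 8 :> R by ring.
by nra.
Qed.

End gauss_expectation.

(** * Gaussian heat operators *)

Lemma scaler_half (R : realType) (V : lmodType R) (v : V) : 2^-1 *: (v + v) = v.
Proof. by rewrite scalerDr -scalerDl (_ : 2^-1 + 2^-1 = 1) ?scale1r//; field. Qed.

Definition seminorm (R : realType) (V : lmodType R) (p : V -> R) :=
  (forall v w, p (v + w) <= p v + p w) /\ (forall a v, p (a *: v) = `|a| * p v).

Definition convex_fun (R : realType) (V : lmodType R) (f : V -> R) :=
  forall v w (t : R), 0 <= t <= 1 -> f ((1 - t) *: v + t *: w) <= (1 - t) * f v + t * f w.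

Section seminorm_theory.
Context {R : realType} {V : lmodType R} (p : V -> R).
Hypothesis sp : seminorm p.
Implicit Types v w : V.

Lemma semi0 : p 0 = 0.
Proof. by rewrite -(scale0r 0) sp.2 normr0 mul0r. Qed.

Lemma semiN v : p (- v) = p v.
Proof. by rewrite -scaleN1r sp.2 normrN1 mul1r. Qed.

Lemma semi_ge0 v : 0 <= p v.
Proof. by have := sp.1 v (- v); rewrite subrr semi0 semiN; lra. Qed.

Lemma semi_sub v w : `|p v - p w| <= p (v - w).
Proof.
rewrite ler_norml; have := sp.1 (v - w) w; have := sp.1 (w - v) v.
by rewrite !subrK -(semiN (w - v)) opprB => h1 h2; apply/andP; split; lra.
Qed.

Lemma semiZ_sqr (a : R) v : p (a *: v) ^+ 2 = a ^+ 2 * p v ^+ 2.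
Proof. by rewrite sp.2 exprMn real_normK ?num_real. Qed.

Lemma convex_semi_sqr : convex_fun (fun v => p v ^+ 2).
Proof.
move=> v w t /andP[t0 t1].
have h : p ((1 - t) *: v + t *: w) <= (1 - t) * p v + t * p w.
  by apply: (le_trans (sp.1 _ _)); rewrite !sp.2 !ger0_norm ?subr_ge0.
have h0 := semi_ge0 ((1 - t) *: v + t *: w).
apply: (@le_trans _ _ (((1 - t) * p v + t * p w) ^+ 2)); first by rewrite ler_sqr ?nnegrE//; lra.
have : 0 <= t * (1 - t) * (p v - p w) ^+ 2 by rewrite mulr_ge0 ?sqr_ge0// mulr_ge0// subr_ge0.
by nra.
Qed.

End seminorm_theory.

Section heat_operator.
Context {R : realType} {V : lmodType R} (p : V -> R).
Hypothesis sp : seminorm p.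
Notation mu := (@lebesgue_measure R).
Implicit Types (f : V -> R) (v w x y z : V).

(** A class that contains [p ^+ 2] and is preserved by [heat], with members continuous and [tame]
    along every line. Regularity is measured by [p] itself, and nonnegativity lets iterated
    integrals be exchanged. *)
Definition quad_lipschitz f := (forall v, 0 <= f v) /\
  exists2 C : R, 0 <= C & forall v w, `|f v - f w| <= C * p (v - w) * (1 + p v + p w).

Definition heat x f : V -> R := fun z => gauss_mean (fun t : R => f (z + t *: x)).

Lemma quad_sqr : quad_lipschitz (fun v => p v ^+ 2).
Proof.
split => [v|]; first exact: sqr_ge0.
exists 1 => // v w; rewrite subr_sqr normrM mul1r.
have := semi_ge0 sp v; have := semi_ge0 sp w => w0 v0.
rewrite (ger0_norm (x := p v + p w)) ?addr_ge0//.
by apply: ler_pM => //; [exact: addr_ge0|exact: semi_sub|rewrite -addrA lerDr].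
Qed.

Lemma line_lip f z x (C : R) : 0 <= C ->
  (forall v w, `|f v - f w| <= C * p (v - w) * (1 + p v + p w)) ->
  forall s t : R, `|f (z + s *: x) - f (z + t *: x)| <=
     C * (`|s - t| * p x) * (1 + 2 * p z + (`|s| + `|t|) * p x).
Proof.
move=> C0 hC s t; apply: (le_trans (hC _ _)).
have -> : z + s *: x - (z + t *: x) = (s - t) *: x by rewrite opprD addrACA subrr add0r scalerBl.
have h r : p (z + r *: x) <= p z + `|r| * p x by rewrite -sp.2; exact: sp.1.
rewrite sp.2 ler_wpM2l ?mulr_ge0 ?(semi_ge0 sp)//.
by have := h s; have := h t; lra.
Qed.

Lemma quad_line_continuous f z x : quad_lipschitz f -> continuous (fun t : R => f (z + t *: x)).
Proof.
move=> [f0 [C C0 hC]] t0.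
pose K := C * p x * (1 + 2 * p z + (2 * `|t0| + 1) * p x).
have K0 : 0 <= K.
  have := semi_ge0 sp; have := normr_ge0 t0 => ? sp0.
  by rewrite /K !mulr_ge0// !addr_ge0// mulr_ge0// addr_ge0// mulr_ge0.
apply/cvgrPdist_le => e e0; near=> t.
have tt : `|t0 - t| <= 1 by near: t; apply: cvgr_dist_le => //; exact: cvg_id.
apply: (le_trans (line_lip z x C0 hC _ _)).
apply: (@le_trans _ _ (`|t0 - t| * (K + 1))).
  have -> : C * (`|t0 - t| * p x) = `|t0 - t| * (C * p x) by ring.
  rewrite -mulrA ler_wpM2l// (@le_trans _ _ K) ?lerDl// /K.
  rewrite ler_wpM2l ?mulr_ge0 ?(semi_ge0 sp)// lerD2l ler_wpM2r ?(semi_ge0 sp)//.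
  have := ler_normB t0 (t0 - t); rewrite subKr; lra.
rewrite -ler_pdivlMr; last by lra.
near: t; apply: cvgr_dist_le; first exact: cvg_id.
by rewrite divr_gt0//; lra.
Unshelve. all: end_near. Qed.

Lemma tame_quad f z x : quad_lipschitz f -> tame (fun t : R => f (z + t *: x)).
Proof.
move=> qf; split; first by apply: continuous_measurable_fun; exact: quad_line_continuous.
have [f0 [C C0 hC]] := qf.
have z0 := semi_ge0 sp z; have x0 := semi_ge0 sp x.
exists (f z + C * p x * (1 + 2 * p z + p x)) => t.
have := line_lip z x C0 hC t 0.
rewrite subr0 normr0 addr0 scale0r addr0 => h.
apply: (@le_trans _ _ (f z + C * (`|t| * p x) * (1 + 2 * p z + `|t| * p x))).
  by rewrite (ger0_norm (f0 _)); have := ler_norm (f (z + t *: x) - f z); lra.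
have -> : C * (`|t| * p x) * (1 + 2 * p z + `|t| * p x) =
  C * p x * (`|t| * (1 + 2 * p z) + `|t| ^+ 2 * p x) by ring.
rewrite real_normK ?num_real// [leRHS]mulrDl; apply: lerD;
  first by rewrite ler_peMr// lerDl sqr_ge0.
rewrite -[leRHS]mulrA ler_wpM2l ?mulr_ge0//.
have tt : `|t| <= 1 + t ^+ 2.
  by rewrite -(real_normK (num_real t)); have := sqr_ge0 (`|t| - 1); have := normr_ge0 t; nra.
have := sqr_ge0 t; nra.
Qed.

Lemma quad_heat x f : quad_lipschitz f -> quad_lipschitz (heat x f).
Proof.
move=> qf; have [f0 [C C0 hC]] := qf; split => [z|]; first by apply: gauss_mean_ge0 => t; exact: f0.
have x0 := semi_ge0 sp x.
pose m := gauss_mean (fun t : R => `|t|).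
have m0 : 0 <= m by apply: gauss_mean_ge0.
exists (C * (1 + 2 * (p x * m))) => [|v w].
  by rewrite mulr_ge0// addr_ge0// mulr_ge0// mulr_ge0.
have tv : tame (fun t : R => f (v + t *: x)) by exact: tame_quad.
have tw : tame (fun t : R => f (w + t *: x)) by exact: tame_quad.
have -> : heat x f v - heat x f w = gauss_mean (fun t : R => f (v + t *: x) + -1 * f (w + t *: x)).
  by rewrite gauss_meanD//; [rewrite gauss_meanZ// mulN1r|exact: tameZ].
have td : tame (fun t : R => f (v + t *: x) + -1 * f (w + t *: x)) by apply: tameD => //;
  exact: tameZ.
apply: (le_trans (gauss_mean_norm td)).
pose u := C * p (v - w).
have u0 : 0 <= u by rewrite mulr_ge0// semi_ge0.
apply: (@le_trans _ _ (gauss_mean (fun t : R => u * (1 + p v + p w) + (u * (2 * p x)) * `|t|))).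
  apply: le_gauss_mean.
  - split; first by apply: measurableT_comp; [exact: normr_measurable|exact: td.1].
    by have [_ [a ha]] := td; exists a => t; rewrite normr_id.
  - by apply: tameD; [exact: tame_cst|exact/tameZ/tame_norm].
  move=> t; rewrite mulN1r; apply: (le_trans (hC _ _)).
  rewrite opprD addrACA subrr addr0 -/u -mulrA -mulrDr ler_wpM2l//.
  have h r : p (r + t *: x) <= p r + `|t| * p x by rewrite -sp.2; exact: sp.1.
  by have := h v; have := h w; lra.
rewrite gauss_meanD; [|exact: tame_cst|exact/tameZ/tame_norm].
rewrite gauss_mean_cst gauss_meanZ; last exact: tame_norm.
rewrite -/m /u.
have := semi_ge0 sp v; have := semi_ge0 sp w; have := semi_ge0 sp (v - w) => h1 h2 h3.
have -> : C * (1 + 2 * (p x * m)) * p (v - w) * (1 + p v + p w) =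
  C * p (v - w) * (1 + p v + p w) + C * p (v - w) * (2 * p x) * m
  + C * p (v - w) * (2 * p x) * m * (p v + p w) by ring.
by rewrite lerDl !mulr_ge0// addr_ge0.
Qed.

Lemma le_heat x f g : quad_lipschitz f -> quad_lipschitz g -> (forall z, f z <= g z) -> forall z,
  heat x f z <= heat x g z.
Proof. by move=> qf qg fg z; apply: le_gauss_mean => [| |t]; [exact: tame_quad..|exact: fg]. Qed.

Lemma convex_heat x f : quad_lipschitz f -> convex_fun f -> convex_fun (heat x f).
Proof.
move=> qf cf v w t t01; rewrite /heat -!gauss_meanZ; [|exact: tame_quad..].
rewrite -gauss_meanD; [|exact/tameZ/tame_quad..].
apply: le_gauss_mean => [| |s]; [exact: tame_quad|by apply: tameD; exact/tameZ/tame_quad|].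
apply: le_trans (cf _ _ _ t01); rewrite le_eqVlt; apply/orP; left; apply/eqP; congr (f _).
by rewrite !scalerDr addrACA -scalerDl subrK scale1r.
Qed.

Lemma heat0 f : heat 0 f = f.
Proof. by apply/funext => z; rewrite /heat; under eq_fun do rewrite scaler0 addr0;
  rewrite gauss_mean_cst. Qed.

Lemma heatN x f : quad_lipschitz f -> heat (- x) f = heat x f.
Proof.
move=> qf; apply/funext => z; rewrite /heat -[RHS]gauss_meanN; last exact: tame_quad.
by congr gauss_mean; apply/funext => t; rewrite scalerN scaleNr.
Qed.

Lemma measurable_plane f z x y : quad_lipschitz f ->
  measurable_fun setT (fun st : R * R => f (z + st.1 *: x + st.2 *: y)).
Proof.
move=> qf; apply: (@caratheodory_measurable R _ (measurableTypeR R) (fun s t => f (z + s *: x + t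
  *: y))) => [t|s].
  under eq_fun do rewrite addrAC.
  exact: quad_line_continuous.
exact: (tame_quad _ _ qf).1.
Qed.

Lemma heat_heat x y f z : quad_lipschitz f -> (heat x (heat y f) z)%:E =
  (\int[mu]_s \int[mu]_t (f (z + s *: x + t *: y) * (gauss_pdf s * gauss_pdf t))%:E)%E.
Proof.
move=> qf; rewrite /heat EFin_gauss_mean; last by apply: (tame_quad z x (quad_heat y qf)).
apply: eq_integral => s _; rewrite EFinM EFin_gauss_mean; last exact: tame_quad.
rewrite -ge0_integralZr//.
- by apply: eq_integral => t _; rewrite -EFinM; congr (_%:E); ring.
- apply/measurable_EFinP; apply: measurable_funM;
  [exact: (tame_quad _ _ qf).1|exact: measurable_gauss_pdf].
- by move=> t _; rewrite lee_fin mulr_ge0 ?gauss_pdf_ge0//; exact: qf.1.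
- by rewrite lee_fin gauss_pdf_ge0.
Qed.

(** The product of two standard Gaussian densities is rotation invariant, so the pair of directions
    may be rotated. The case [s = 0] is apart because the shears divide by [s]; only signs change
    there. *)
Lemma heat_rot (c s : R) x y f : quad_lipschitz f -> c ^+ 2 + s ^+ 2 = 1 ->
  heat (c *: x + s *: y) (heat (- s *: x + c *: y) f) = heat x (heat y f).
Proof.
move=> qf cs; have [s0|s0] := eqVneq s 0.
  move: cs; rewrite s0 oppr0 !scale0r addr0 add0r expr0n addr0 => /eqP.
  rewrite -subr_eq0 -[X in _ - X](expr1n _ 2) subr_sqr mulf_eq0 subr_eq0 addr_eq0 => /orP[] /eqP ->.
    by rewrite !scale1r.
  by rewrite !scaleN1r (heatN _ qf) heatN//; exact: quad_heat.
apply/funext => z; apply: EFin_inj.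
rewrite [LHS](heat_heat _ _ _ qf).
rewrite [RHS](heat_heat _ _ _ qf).
pose G := fun u v : R => (f (z + u *: x + v *: y) * (gauss_pdf u * gauss_pdf v))%:E.
have GE a b : (f (z + a *: (c *: x + s *: y) + b *: (- s *: x + c *: y)) * (gauss_pdf a *
  gauss_pdf b))%:E =
    G (c * a - s * b) (s * a + c * b).
  rewrite /G (gauss_pdf_rot a b cs); congr ((f _ * _)%:E).
  rewrite -!addrA; congr (z + _); rewrite !scalerDr !scalerA addrACA -!scalerDl.
  by congr (_ *: _ + _ *: _); ring.
rewrite -[RHS](@integral_rot R G c s cs s0).
- apply: eq_integral => a _; apply: eq_integral => b _; exact: GE.
- apply/measurable_EFinP; apply: measurable_funM; first exact: measurable_plane.
  apply: measurable_funM; apply: measurableT_comp; try exact: measurable_gauss_pdf.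
    exact: measurable_fst.
  exact: measurable_snd.
- by move=> u v; rewrite lee_fin mulr_ge0 ?qf.1// mulr_ge0 ?gauss_pdf_ge0.
Qed.

(** Jensen's inequality: pairing [t] with [- t] reduces it to convexity at the midpoint [z]. *)
Lemma heat_ge x f z : quad_lipschitz f -> convex_fun f -> f z <= heat x f z.
Proof.
move=> qf cf; have tf := tame_quad z x qf.
have -> : heat x f z = gauss_mean (fun t : R => 2^-1 * (f (z + t *: x) + f (z + (- t) *: x))).
  rewrite gauss_meanZ; last by apply: tameD => //; exact: (tameN tf).
  rewrite gauss_meanD//; last exact: (tameN tf).
  by rewrite (gauss_meanN tf) /heat; field.
rewrite -[leLHS]gauss_mean_cst; apply: le_gauss_mean; [exact: tame_cst| |].
  by apply: tameZ; apply: tameD => //; exact: (tameN tf).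
move=> t; have := cf (z + t *: x) (z + (- t) *: x) 2^-1.
have -> : 1 - 2^-1 = 2^-1 :> R by field.
rewrite -scalerDr scaleNr addrACA subrr addr0 scaler_half.
by rewrite mulrDr; apply; apply/andP; split; lra.
Qed.

Lemma convex_mono f z x (t : R) : convex_fun f -> 1 <= t ->
  (f (z + x) + f (z - x)) <= (f (z + t *: x) + f (z - t *: x)).
Proof.
move=> cf t1.
have t0 : t != 0 by lra.
(* The weight for which [z + x] is the convex combination of [z - t *: x] and [z + t *: x];
   exchanging the two endpoints gives [z - x]. *)
pose a := (1 + t^-1) / 2.
have ti : 0 < t^-1 by rewrite invr_gt0; lra.
have ti1 : t^-1 <= 1 by rewrite invf_le1; lra.
have h1 := cf (z - t *: x) (z + t *: x) a.
have h2 := cf (z + t *: x) (z - t *: x) a.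
have e1 : (1 - a) *: (z - t *: x) + a *: (z + t *: x) = z + x.
  rewrite !scalerDr addrACA -scalerDl subrK scale1r scalerN -scaleNr !scalerA -scalerDl;
    congr (_ + _).
  by rewrite (_ : _ + _ = 1) ?scale1r// /a; field.
have e2 : (1 - a) *: (z + t *: x) + a *: (z - t *: x) = z - x.
  rewrite !scalerDr addrACA -scalerDl subrK scale1r scalerN -scaleNr !scalerA -scalerDl;
    congr (_ + _).
  by rewrite (_ : _ + _ = -1) ?scaleN1r// /a; field.
rewrite e1 in h1; rewrite e2 in h2.
have ha : 0 <= a <= 1 by rewrite /a; apply/andP; split; lra.
by have := h1 ha; have := h2 ha; lra.
Qed.

(** The symmetrised function [b] is convex and even, so it is at least [b 0] everywhere and at least
    [b 1] on [[1, 2]]. Integrating gives [(1 - kappa) * b 0 + kappa * b 1], which dominates the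
    value at [kappa] by convexity. *)
Lemma bernoulli_le_heat x f z : quad_lipschitz f -> convex_fun f ->
  2^-1 * (f (z + kappa *: x) + f (z - kappa *: x)) <= heat x f z.
Proof.
move=> qf cf; have tf := tame_quad z x qf.
pose b (t : R) := 2^-1 * (f (z + t *: x) + f (z - t *: x)).
have tb : tame b.
  apply: tameZ; apply: tameD => //.
  by have := tameN tf; under eq_fun do rewrite scaleNr.
have -> : heat x f z = gauss_mean b.
  rewrite gauss_meanZ; last first.
    by apply: tameD => //; have := tameN tf; under eq_fun do rewrite scaleNr.
  rewrite gauss_meanD//; last by have := tameN tf; under eq_fun do rewrite scaleNr.
  rewrite [X in _ + X](_ : _ = gauss_mean (fun t : R => f (z + (- t) *: x))).
    by rewrite (gauss_meanN tf) /heat; field.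
  by congr gauss_mean; apply/funext => t; rewrite scaleNr.
have b0 t : b 0 <= b t.
  have := cf (z + t *: x) (z - t *: x) 2^-1.
  have -> : 1 - 2^-1 = 2^-1 :> R by field.
  rewrite -scalerDr addrACA subrr addr0 scaler_half.
  rewrite /b scale0r subr0 addr0 => h.
  have : 0 <= (2^-1 : R) <= 1 by apply/andP; split; lra.
  by move=> /h; lra.
have k01 : 0 <= (kappa : R) <= 1 by rewrite kappa_le1 andbT ltW// kappa_gt0.
apply: (@le_trans _ _ ((1 - kappa) * b 0 + kappa * b 1)).
  have h1 := cf z (z + x) kappa k01; have h2 := cf z (z - x) kappa k01.
  rewrite scalerDr addrA -scalerDl subrK scale1r in h1.
  rewrite scalerDr addrA -scalerDl subrK scale1r scalerN in h2.
  by rewrite /b !scale0r !subr0 !addr0 !scale1r; lra.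
have -> : (1 - kappa) * b 0 + kappa * b 1 = gauss_mean (fun t : R => b 0 + (b 1 - b 0) * \1_`[1,
  2] t).
  rewrite gauss_meanD; [|exact: tame_cst|exact/tameZ/tame_indic12].
  by rewrite gauss_mean_cst gauss_meanZ; [rewrite -/kappa; ring|exact: tame_indic12].
apply: le_gauss_mean => // [|t].
  by apply: tameD; [exact: tame_cst|exact/tameZ/tame_indic12].
rewrite indicE; case: (boolP (t \in _)) => [|_]; last by rewrite mulr0 addr0.
rewrite inE/= in_itv/= => /andP[t1 _]; rewrite mulr1 addrC subrK.
by rewrite /b !scale1r ler_pM2l ?invr_gt0//; exact: convex_mono.
Qed.

End heat_operator.

(** * Rademacher and Gaussian averages *)

Section lists.
Context {R : realType} {V : lmodType R}.
Implicit Types (f : V -> R) (xs ys : seq V) (l : seq (R * V)).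

(* [rad xs f z] is the mean of [f (z + sum_k eps_k x_k)] over independent signs [eps_k], and
   [heats xs f z] that of [f (z + sum_k g_k x_k)] over independent standard Gaussians [g_k]. *)
Fixpoint heats xs f : V -> R := if xs is x :: xs' then heat x (heats xs' f) else f.

Fixpoint rad xs f : V -> R :=
  if xs is x :: xs' then fun z => 2^-1 * (rad xs' f (z + x) + rad xs' f (z - x)) else f.

Definition comb l : V := \sum_(ax <- l) ax.1 *: ax.2.

Definition sumsq l : R := \sum_(ax <- l) ax.1 ^+ 2.

Lemma comb_cons a x l : comb ((a, x) :: l) = a *: x + comb l.
Proof. by rewrite /comb big_cons. Qed.

Lemma sumsq_cons a x l : sumsq ((a, x) :: l) = a ^+ 2 + sumsq l.
Proof. by rewrite /sumsq big_cons. Qed.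

Lemma sumsq_ge0 l : 0 <= sumsq l.
Proof. by apply: sumr_ge0 => i _; exact: sqr_ge0. Qed.

Lemma comb0 l : sumsq l = 0 -> comb l = 0.
Proof.
elim: l => [|[a x] l IH]; first by rewrite /comb big_nil.
rewrite sumsq_cons comb_cons => h.
have := sumsq_ge0 l; have := sqr_ge0 a => a0 l0.
have /eqP : a ^+ 2 = 0 by lra.
by rewrite sqrf_eq0 => /eqP ->; rewrite IH ?scale0r ?addr0//; lra.
Qed.

Variable p : V -> R.
Hypothesis sp : seminorm p.

Lemma quad_heats xs f : quad_lipschitz p f -> quad_lipschitz p (heats xs f).
Proof. by move=> qf; elim: xs => //= x xs IH; exact: quad_heat. Qed.

Lemma convex_heats xs f : quad_lipschitz p f -> convex_fun f -> convex_fun (heats xs f).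
Proof.
by move=> qf cf; elim: xs => //= x xs IH; apply: (convex_heat sp) => //; exact: quad_heats.
Qed.

Lemma heats_ge xs f z : quad_lipschitz p f -> convex_fun f -> f z <= heats xs f z.
Proof.
move=> qf cf; elim: xs z => //= x xs IH z; apply: (le_trans (IH z)).
by apply: (heat_ge sp); [exact: quad_heats|exact: convex_heats].
Qed.

Lemma rad_le_heats xs f z : quad_lipschitz p f -> convex_fun f ->
  rad [seq kappa *: x | x <- xs] f z <= heats xs f z.
Proof.
move=> qf cf; elim: xs z => //= x xs IH z.
apply: le_trans (bernoulli_le_heat sp x z (quad_heats xs qf) (convex_heats xs qf cf)).
by rewrite ler_pM2l ?invr_gt0// lerD.
Qed.

Lemma convex_rad xs f : convex_fun f -> convex_fun (rad xs f).
Proof.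
move=> cf; elim: xs => //= x xs IH v w t t01.
have h y : (1 - t) *: v + t *: w + y = (1 - t) *: (v + y) + t *: (w + y).
  by rewrite !scalerDr addrACA -scalerDl subrK scale1r.
rewrite !h; have := IH (v + x) (w + x) t t01; have := IH (v - x) (w - x) t t01; lra.
Qed.

Lemma convex_half f z x : convex_fun f -> f z <= 2^-1 * (f (z + x) + f (z - x)).
Proof.
move=> cf; have := cf (z + x) (z - x) 2^-1.
have -> : 1 - 2^-1 = 2^-1 :> R by field.
rewrite -scalerDr addrACA subrr addr0 scaler_half.
have h : 0 <= (2^-1 : R) <= 1 by apply/andP; split; lra.
by move=> /(_ h); lra.
Qed.

Lemma rad_ge xs f z : convex_fun f -> f z <= rad xs f z.
Proof.
move=> cf; elim: xs z => //= x xs IH z.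
by have := IH (z + x); have := IH (z - x); have := convex_half z x cf; lra.
Qed.

Lemma rad_ge0 xs f z : (forall v, 0 <= f v) -> 0 <= rad xs f z.
Proof. by move=> f0; elim: xs z => //= x xs IH z; rewrite mulr_ge0// addr_ge0. Qed.

Lemma rad_scale (a : R) xs z :
  rad [seq a *: x | x <- xs] (fun v => p v ^+ 2) (a *: z) = a ^+ 2 * rad xs (fun v => p v ^+ 2) z.
Proof.
elim: xs z => [|x xs IH] z /=; first exact: semiZ_sqr.
by rewrite -scalerDr -scalerBr !IH; ring.
Qed.

Lemma rad_cat_le xs ys f z : convex_fun f -> rad xs f z <= rad (xs ++ ys) f z.
Proof.
move=> cf; elim: xs z => /= [|x xs IH] z; first exact: rad_ge.
by rewrite ler_pM2l ?invr_gt0// lerD.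
Qed.

(** Averaging a convex function over the sign of a discarded vector can only increase its value. *)
Lemma rad_filter_le (P : pred V) xs f z : convex_fun f ->
  rad [seq x <- xs | P x] f z <= rad xs f z.
Proof.
move=> cf; elim: xs z => //= x xs IH z; case: ifP => _ /=.
  by rewrite ler_pM2l ?invr_gt0// lerD.
by apply: (le_trans (IH z)); apply: convex_half; exact: convex_rad.
Qed.

(* Duality: [a |-> sum a_k x_k] maps the Euclidean unit ball into the [p]-ball of squared
   radius [rad xs]. *)
Lemma comb_le_rad l (a : R) z :
  p (a *: z + comb l) ^+ 2 <= (a ^+ 2 + sumsq l) * rad (unzip2 l) (fun v => p v ^+ 2) z.
Proof.
elim: l a z => [|[b x] l IH] a z.
  by rewrite /comb /sumsq !big_nil !addr0 (semiZ_sqr sp).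
rewrite comb_cons sumsq_cons /=.
set r1 := rad _ _ (z + x); set r2 := rad _ _ (z - x).
have {}IH c y : p (c *: y + 2^-1 *: comb l) ^+ 2 <=
    (c ^+ 2 + 4^-1 * sumsq l) * rad (unzip2 l) (fun v => p v ^+ 2) y.
  have -> : c *: y + 2^-1 *: comb l = 2^-1 *: ((2 * c) *: y + comb l).
    by rewrite scalerDr scalerA mulrA mulVf ?pnatr_eq0// mul1r.
  rewrite (semiZ_sqr sp).
  have := IH (2 * c) y; set r := rad _ _ _; set q := p _ => h.
  have -> : (c ^+ 2 + 4^-1 * sumsq l) * r = 2^-1 ^+ 2 * (((2 * c) ^+ 2 + sumsq l) * r) by field.
  by rewrite ler_wpM2l ?sqr_ge0.
(* The vector is shared between the two branches of [rad]: half of [comb l] goes to each, and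
   (a+b)/2, (a-b)/2 are the coefficients of [z + x], [z - x] that recombine to a z + b x. *)
set P1 := p ((2^-1 * (a + b)) *: (z + x) + 2^-1 *: comb l).
set P2 := p ((2^-1 * (a - b)) *: (z - x) + 2^-1 *: comb l).
have h1 : P1 ^+ 2 <= ((2^-1 * (a + b)) ^+ 2 + 4^-1 * sumsq l) * r1 := IH _ _.
have h2 : P2 ^+ 2 <= ((2^-1 * (a - b)) ^+ 2 + 4^-1 * sumsq l) * r2 := IH _ _.
have -> : a *: z + (b *: x + comb l) =
  ((2^-1 * (a + b)) *: (z + x) + 2^-1 *: comb l) + ((2^-1 * (a - b)) *: (z - x) + 2^-1 *: comb l).
  rewrite addrACA -scalerDl (_ : 2^-1 + 2^-1 = 1) ?scale1r; last by field.
  rewrite addrA; congr (_ + _); rewrite scalerDr scalerBr addrACA -scalerDl -scalerBl.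
  by congr (_ *: _ + _ *: _); field.
have r10 : 0 <= r1 by apply: rad_ge0 => v; exact: sqr_ge0.
have r20 : 0 <= r2 by apply: rad_ge0 => v; exact: sqr_ge0.
have P10 : 0 <= P1 := semi_ge0 sp _.
have P20 : 0 <= P2 := semi_ge0 sp _.
have s0 := sumsq_ge0 l.
have q1 := sqr_ge0 (2^-1 * (a + b)); have q2 := sqr_ge0 (2^-1 * (a - b)).
have eA : (a ^+ 2 + (b ^+ 2 + sumsq l)) * (2^-1 * (r1 + r2)) =
  (((2^-1 * (a + b)) ^+ 2 + 4^-1 * sumsq l) + ((2^-1 * (a - b)) ^+ 2 + 4^-1 * sumsq l)) * (r1 + r2).
  by field.
rewrite eA; move: h1 h2; set A1 := _ + 4^-1 * _; set A2 := _ + 4^-1 * _ => h1 h2.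
have A10 : 0 <= A1 by rewrite addr_ge0// mulr_ge0.
have A20 : 0 <= A2 by rewrite addr_ge0// mulr_ge0.
apply: (@le_trans _ _ ((P1 + P2) ^+ 2)).
  by rewrite ler_sqr ?nnegrE ?(semi_ge0 sp) ?addr_ge0//; exact: sp.1.
(* The cross term is an arithmetic-geometric mean inequality, since the square of [P1 * P2] is at
   most [(A1 * r1) * (A2 * r2)]. *)
suff : 2 * (P1 * P2) <= A1 * r2 + A2 * r1 by lra.
rewrite -ler_sqr ?nnegrE; [|by rewrite !mulr_ge0|by rewrite addr_ge0 ?mulr_ge0].
have h3 : (P1 ^+ 2) * (P2 ^+ 2) <= (A1 * r1) * (A2 * r2) by apply: ler_pM => //; exact: sqr_ge0.
have h4 := sqr_ge0 (A1 * r2 - A2 * r1).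
have -> : (2 * (P1 * P2)) ^+ 2 = 4 * (P1 ^+ 2 * P2 ^+ 2) by ring.
have -> : (A1 * r2 + A2 * r1) ^+ 2 = (A1 * r2 - A2 * r1) ^+ 2 + 4 * (A1 * r1 * (A2 * r2)) by ring.
by lra.
Qed.

Definition additive_form (phi : V -> R) := forall a v w, phi (a *: v + w) = a * phi v + phi w.

(** The covariance of sum_k g_k x_k as a quadratic form on linear functionals. *)
Definition sumform xs (phi : V -> R) : R := \sum_(x <- xs) phi x ^+ 2.

(* Successive plane rotations move all of the coefficients to one vector. *)
Lemma heats_align l : 0 < sumsq l -> exists u xs,
  [/\ Num.sqrt (sumsq l) *: u = comb l,
      forall f, quad_lipschitz p f -> heats (u :: xs) f = heats (unzip2 l) f &
      forall phi, additive_form phi -> sumform (u :: xs) phi = sumform (unzip2 l) phi].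
Proof.
elim: l => [|[a x] l IH]; first by rewrite /sumsq big_nil ltxx.
rewrite sumsq_cons comb_cons => l0.
have [m0|m0] := eqVneq (sumsq l) 0.
  have phi0 phi : additive_form phi -> phi 0 = 0.
    by move=> hphi; have := hphi 1 0 0; rewrite scale1r addr0 mul1r; lra.
  rewrite m0 addr0 sqrtr_sqr comb0// addr0; rewrite m0 addr0 in l0.
  have [a0|a0] := ltrP 0 a.
    by exists x, (unzip2 l); rewrite gtr0_norm.
  exists (- x), (unzip2 l); rewrite ler0_norm//; split.
  - by rewrite scalerN scaleNr opprK.
  - by move=> f qf /=; rewrite (heatN sp)//; exact: quad_heats.
  - move=> phi hphi; rewrite /sumform !big_cons; congr (_ + _).
    have -> : - x = -1 *: x + 0 by rewrite scaleN1r addr0.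
    by rewrite hphi phi0// addr0 mulN1r sqrrN.
have m1 : 0 < sumsq l by rewrite lt0r m0 sumsq_ge0.
have [u [xs [hu hheat hform]]] := IH m1.
set lam := Num.sqrt (a ^+ 2 + sumsq l); set mm := Num.sqrt (sumsq l) in hu *.
have lam0 : 0 < lam by rewrite sqrtr_gt0.
have lam2 : lam ^+ 2 = a ^+ 2 + mm ^+ 2 by rewrite !sqr_sqrtr ?ltW.
pose c := a / lam; pose s := mm / lam.
have cs : c ^+ 2 + s ^+ 2 = 1.
  by rewrite /c /s !expr_div_n -mulrDl -lam2 divff// expf_neq0// lt0r_neq0.
exists (c *: x + s *: u), ((- s *: x + c *: u) :: xs); split.
- rewrite scalerDr !scalerA /c /s !(mulrC lam) !divfK ?lt0r_neq0//.
  by rewrite hu.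
- move=> f qf /=; rewrite (heat_rot sp)//; last exact: quad_heats.
  by rewrite -[heats (unzip2 l) f]hheat.
- move=> phi hphi; rewrite /sumform big_cons [RHS]big_cons -/(sumform (unzip2 l) phi) -hform//.
  rewrite /sumform !big_cons !addrA; congr (_ + _).
  have phi0 : phi 0 = 0 by have := hphi 1 0 0; rewrite scale1r addr0 mul1r; lra.
  have phiZ b v : phi (b *: v) = b * phi v by have := hphi b v 0; rewrite !addr0 phi0 addr0.
  rewrite !hphi !phiZ.
  have -> : (c * phi x + s * phi u) ^+ 2 + (- s * phi x + c * phi u) ^+ 2 =
    (c ^+ 2 + s ^+ 2) * (phi x ^+ 2 + phi u ^+ 2) by ring.
  by rewrite cs mul1r.
Qed.

(* The argument is split into a clipped part [v], treated by convexity, and a tail [w], treated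
   by the Euclidean bound on [p]. *)
Lemma heats_le_rad (dot : V -> V -> R) (rho T : R) xs v w :
  0 <= rho -> 0 < T ->
  (forall v, p v ^+ 2 <= rho * dot v v) ->
  (forall v x t, dot (v + t *: x) (v + t *: x) = dot v v + 2 * t * dot v x + t ^+ 2 * dot x x) ->
  heats xs (fun v => p v ^+ 2) (v + w) <=
  2 * rad [seq T *: x | x <- xs] (fun v => p v ^+ 2) v +
  2 * rho * (dot w w + gauss_mean (fun t => (t - clip T t) ^+ 2) * \sum_(x <- xs) dot x x).
Proof.
move=> rho0 T0 prho hdot.
set eta := gauss_mean _.
elim: xs v w => [|x xs IH] v w.
  rewrite big_nil mulr0 addr0 /=.
  have h := sp.1 v w; have := semi_ge0 sp v; have := semi_ge0 sp w; have := semi_ge0 sp (v + w).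
  move=> h1 h2 h3; have h4 := prho w; have h5 := sqr_ge0 (p v - p w).
  have : p (v + w) ^+ 2 <= (p v + p w) ^+ 2 by rewrite ler_sqr ?nnegrE ?addr_ge0.
  by nra.
rewrite big_cons /=.
set q := rad _ _ in IH *; set S := \sum_(_ <- _) _ in IH *.
have cq : convex_fun q by apply: convex_rad; exact: convex_semi_sqr.
(* The integrand will be bounded by [k0 + k1 * th + k2 * (t - th) + k3 * (t - th) ^+ 2] with [th]
   the clipped value of [t]. The two linear terms are odd in [t] and have mean zero. *)
pose k0 := 2 * (2^-1 * (q (v + T *: x) + q (v - T *: x))) + 2 * rho * (dot w w + eta * S).
pose k1 := (q (v + T *: x) - q (v - T *: x)) / T.
pose k2 := 4 * rho * dot w x.
pose k3 := 2 * rho * dot x x.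
have T0' := ltW T0.
have tc := tame_clip T0'; have ts := tame_clip_sub T0'; have ts2 := tame_clip_sub2 T0'.
have -> : 2 * (2^-1 * (q (v + T *: x) + q (v - T *: x))) +
    2 * rho * (dot w w + eta * (dot x x + S)) = k0 + k3 * eta.
  by rewrite /k0 /k3; ring.
have e1 : gauss_mean (clip T) = 0 by apply: gauss_mean_odd => // t; exact: clipN.
have e2 : gauss_mean (fun t => t - clip T t) = 0.
  by apply: gauss_mean_odd => // t; rewrite clipN//; ring.
have -> : k0 + k3 * eta = gauss_mean (fun t => (k0 + k1 * clip T t) +
    (k2 * (t - clip T t) + k3 * (t - clip T t) ^+ 2)).
  have tA := tameD (tame_cst k0) (tameZ k1 tc).
  have tB := tameD (tameZ k2 ts) (tameZ k3 ts2).
  rewrite (gauss_meanD tA tB) (gauss_meanD (tame_cst k0) (tameZ k1 tc)) (gauss_meanD (tameZ k2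
    ts) (tameZ k3 ts2)).
  by rewrite gauss_mean_cst (gauss_meanZ k1 tc) (gauss_meanZ k2 ts) (gauss_meanZ k3 ts2) e1 e2
    !mulr0 addr0 add0r.
apply: le_gauss_mean => [| |t].
- by apply: (tame_quad sp); apply: quad_heats; exact: quad_sqr.
- by apply: tameD; apply: tameD; try exact: tameZ; exact: tame_cst.
have -> : v + w + t *: x = (v + clip T t *: x) + (w + (t - clip T t) *: x).
  by rewrite addrACA -scalerDl [clip T t + _]addrC subrK.
apply: (le_trans (IH _ _)).
rewrite hdot /k0 /k1 /k2 /k3; set th := clip T t.
have /andP[th1 th2] : - T <= th <= T by rewrite -ler_norml clip_bound.
(* The position of [th] in the interval from [- T] to [T]: convexity of [q] between [v - T *: x] and
   [v + T *: x] gives a bound affine in [th]. *)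
pose lam := (th / T + 1) / 2.
have thT : -1 <= th / T <= 1.
  by rewrite ler_pdivlMr// ler_pdivrMr// mulN1r mul1r th1 th2.
have l01 : 0 <= lam <= 1 by rewrite /lam; apply/andP; split; lra.
have := cq (v - T *: x) (v + T *: x) lam l01.
have -> : (1 - lam) *: (v - T *: x) + lam *: (v + T *: x) = v + th *: x.
  rewrite !scalerDr addrACA -scalerDl subrK scale1r scalerN -scaleNr !scalerA -scalerDl;
    congr (_ + _ *: _).
  by rewrite /lam; field; rewrite lt0r_neq0.
set q1 := q (v + _); set q2 := q (v + T *: x); set q3 := q (v - T *: x) => hq.
have -> : (q2 - q3) / T * th = (q2 - q3) * (th / T) by rewrite mulrAC mulrA.
by move: hq; rewrite /lam; set th' := th / T; nra.
Qed.

End lists.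

(** * Selecting few vectors *)

Section barrier.
Context {R : realType}.

Lemma tr_scalar_mx1 (X : 'M[R]_1) : X 0 0 = X^T 0 0.
Proof. by rewrite mxE. Qed.

Section quadratic_forms.
Variable k : nat.
Implicit Types (M N Q : 'M[R]_k) (v w x y : 'cV[R]_k).

Definition bil M x y : R := (x^T *m M *m y) 0 0.

Lemma bilDl M x y z : bil M (x + y) z = bil M x z + bil M y z.
Proof. by rewrite /bil linearD/= !mulmxDl mxE. Qed.

Lemma bilDr M x y z : bil M x (y + z) = bil M x y + bil M x z.
Proof. by rewrite /bil mulmxDr mxE. Qed.

Lemma bilZl M a x y : bil M (a *: x) y = a * bil M x y.
Proof. by rewrite /bil linearZ/= -!scalemxAl mxE. Qed.

Lemma bilZr M a x y : bil M x (a *: y) = a * bil M x y.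
Proof. by rewrite /bil -scalemxAr mxE. Qed.

Lemma bilDm M N x y : bil (M + N) x y = bil M x y + bil N x y.
Proof. by rewrite /bil mulmxDr mulmxDl mxE. Qed.

Lemma bilZm M a x y : bil (a *: M) x y = a * bil M x y.
Proof. by rewrite /bil -scalemxAr -scalemxAl mxE. Qed.

Lemma bilC M x y : M^T = M -> bil M x y = bil M y x.
Proof.
by move=> sM; rewrite /bil tr_scalar_mx1 !trmx_mul trmxK sM mulmxA.
Qed.

Lemma bil1 x : bil 1%:M x x = \sum_i x i 0 ^+ 2.
Proof. by rewrite /bil mulmx1 mxE; apply: eq_bigr => i _; rewrite mxE. Qed.

Lemma bil_outer v x y : bil (v *m v^T) x y = (v^T *m x) 0 0 * (v^T *m y) 0 0.
Proof.
rewrite /bil mulmxA -mulmxA mxE big_ord1; congr (_ * _).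
by rewrite tr_scalar_mx1 trmx_mul trmxK.
Qed.

Definition posdef M := M^T = M /\ forall x, x != 0 -> 0 < bil M x x.

Lemma posdef_ge0 M x : posdef M -> 0 <= bil M x x.
Proof.
move=> [_ pM]; have [->|/pM/ltW//] := eqVneq x 0.
by rewrite /bil mulmx0 mxE.
Qed.

Lemma posdef_unit M : posdef M -> M \in unitmx.
Proof.
move=> [sM pM]; rewrite -row_free_unit -kermx_eq0; apply/eqP/row_matrixP => i.
rewrite row0; apply/eqP/negPn/negP => ri.
have : (row i (kermx M))^T != 0 by rewrite -trmx0 (inj_eq trmx_inj).
move=> /pM; rewrite /bil trmxK -row_mul mulmx_ker row0 mul0mx mxE ltxx//.
Qed.

Lemma posdef_inv M : posdef M -> posdef (invmx M).
Proof.
move=> pM; have uM := posdef_unit pM; split; first by rewrite trmx_inv pM.1.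
move=> x x0; have -> : bil (invmx M) x x = bil M (invmx M *m x) (invmx M *m x).
  rewrite /bil trmx_mul trmx_inv pM.1 -!mulmxA; congr ((_ *m _) 0 0).
  by rewrite [RHS]mulmxA mulVmx// mul1mx.
apply: pM.2; apply: contra_neq x0 => h.
by rewrite -[x]mul1mx -(mulmxV uM) -mulmxA h mulmx0.
Qed.

Lemma mxtrace_bil Q : \tr Q = \sum_i bil Q (delta_mx i 0) (delta_mx i 0).
Proof.
by apply: eq_bigr => i _; rewrite /bil trmx_delta -rowE -colE !mxE.
Qed.

Lemma mxtrace_frame n (O : 'M[R]_(n, k)) Q : O^T *m O = 1%:M ->
  \sum_i bil Q (row i O)^T (row i O)^T = \tr Q.
Proof.
move=> OO; rewrite -[in RHS](mulmx1 Q) -OO mulmxA mxtrace_mulC mulmxA.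
apply: eq_bigr => i _; rewrite /bil trmxK.
by rewrite -row_mul tr_row !mxE; apply: eq_bigr => j _; rewrite !mxE.
Qed.

(* One step of the upper barrier argument of Batson, Spielman and Srivastava: the barrier moves by
   one and the potential [tr (invmx M)] does not increase. *)
Lemma barrier_step n (O : 'M[R]_(n, k)) (s : 'I_n -> R) M :
  (0 < k)%N -> O^T *m O = 1%:M -> (forall i, 0 <= s i) -> (forall i, row i O = 0 -> s i = 0) ->
  posdef M -> \tr (invmx M) <= 1 -> 0 < \sum_i s i ->
  exists t i, [/\ 0 < t, \sum_i s i <= 2 * (t * s i),
    posdef (M + 1%:M - t *: ((row i O)^T *m row i O)) &
    \tr (invmx (M + 1%:M - t *: ((row i O)^T *m row i O))) <= 1].
Proof.
move=> k0 OO s0 srow pM trM S0; set S := \sum_i s i.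
pose M' := M + 1%:M; pose R' := invmx M'; pose R0 := invmx M.
have pM' : posdef M'.
  split; first by rewrite linearD/= pM.1 trmx1.
  move=> x x0; rewrite bilDm; apply: ltr_wpDr; last exact: pM.2.
  by rewrite bil1; apply: sumr_ge0 => i _; exact: sqr_ge0.
have uM := posdef_unit pM; have uM' := posdef_unit pM'.
have pR0 := posdef_inv pM; have pR' := posdef_inv pM'.
have res : R0 - R' = R0 *m R'.
  transitivity (R0 *m M' *m R' - R0 *m M *m R').
    by rewrite -mulmxA mulmxV// mulmx1 mulVmx// mul1mx.
  by rewrite -mulmxBl -mulmxBr /M' addrAC subrr add0r mulmx1.
have R2E x : bil (R' *m R') x x = bil 1%:M (R' *m x) (R' *m x).
  by rewrite /bil mulmx1 trmx_mul pR'.1 !mulmxA.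
have R2pos x : x != 0 -> 0 < bil (R' *m R') x x.
  move=> x0; rewrite R2E bil1; rewrite lt0r sumr_ge0 ?andbT; last by move=> i _; exact: sqr_ge0.
  apply: contra_neq x0 => /eqP; rewrite psumr_eq0; last by move=> i _; exact: sqr_ge0.
  move=> /allP h; have : R' *m x = 0.
    apply/matrixP => i j; rewrite !ord1 [RHS]mxE.
    by have := h i (mem_index_enum _); rewrite sqrf_eq0 => /eqP.
  by move=> e; rewrite -[x]mul1mx -(mulmxV uM') -mulmxA e mulmx0.
pose D := \tr R0 - \tr R'.
have DE : D = \tr (R0 *m R') by rewrite /D -linearB/= res.
(* By the resolvent identity the difference of the two sides is tr(R' R0 R'), a sum of values of the
   positive form of [R0]. *)
have D2 : \tr (R' *m R') <= D.
  rewrite DE -subr_ge0 -linearB/= -mulmxBl res mxtrace_mulC mxtrace_bil.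
  apply: sumr_ge0 => i _.
  have -> : bil (R' *m (R0 *m R')) (delta_mx i 0) (delta_mx i 0) =
            bil R0 (R' *m delta_mx i 0) (R' *m delta_mx i 0).
    by rewrite /bil [in RHS]trmx_mul pR'.1 !mulmxA.
  exact: posdef_ge0.
have D0 : 0 < D.
  apply: lt_le_trans D2; rewrite mxtrace_bil (bigD1 (Ordinal k0))//= ltr_pwDl//.
    apply: R2pos; apply/negP => /eqP/matrixP/(_ (Ordinal k0) 0); rewrite !mxE !eqxx => /eqP.
    by rewrite oner_eq0.
  apply: sumr_ge0 => i _; rewrite R2E bil1; apply: sumr_ge0 => j _; exact: sqr_ge0.
pose v i := (row i O)^T.
(* A rank-one update along [v i] with step [(U i)^-1] raises the potential by exactly [D], which is
   what moving the barrier has gained. As the rows form a tight frame, the [U i] sum to at most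
   2. *)
pose U i := bil (R' *m R') (v i) (v i) / D + bil R' (v i) (v i).
have U0 i : v i != 0 -> 0 < U i.
  by move=> vi; rewrite /U addr_gt0 ?divr_gt0 ?R2pos//; exact: pR'.2.
have Uz i : v i = 0 -> U i = 0 /\ s i = 0.
  move=> vi; split; first by rewrite /U vi /bil !mulmx0 mxE mul0r addr0.
  by apply: srow; apply: trmx_inj; rewrite trmx0.
have SU : \sum_i U i <= 2.
  rewrite big_split/= -mulr_suml !mxtrace_frame//.
  have : \tr (R' *m R') / D <= 1 by rewrite ler_pdivrMr// mul1r.
  have := ltW D0; rewrite /D; rewrite -/R0 in trM; lra.
(* Otherwise summing over [i] would give 2 S < 2 S; the strict inequality comes from an index of
   positive weight, whose row is nonzero. *)
have [i [vi hi]] : exists i, v i != 0 /\ S * U i <= 2 * s i.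
  apply: contrapT => hn.
  have hlt i : v i != 0 -> 2 * s i < S * U i.
    by move=> vi; rewrite ltNge; apply/negP => h; apply: hn; exists i.
  have hle i : 2 * s i <= S * U i.
    have [/Uz[-> ->]|/hlt/ltW//] := eqVneq (v i) 0; by rewrite !mulr0.
  have [i0 si0] : exists i, 0 < s i.
    apply: contrapT => hs; move: S0; rewrite ltNge => /negP; apply.
    by apply: sumr_le0 => i _; rewrite leNgt; apply/negP => h; apply: hs; exists i.
  have vi0 : v i0 != 0 by apply/negP => /eqP/Uz[_ h]; rewrite h ltxx in si0.
  have : \sum_i (2 * s i) < \sum_i (S * U i).
    rewrite (bigD1 i0)//= [ltRHS](bigD1 i0)//=; apply: ltr_leD; first exact: hlt.
    by apply: ler_sum => j _.
  have h : S * (\sum_i U i) <= S * 2 := ler_wpM2l (ltW S0) SU.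
  by rewrite -!mulr_sumr -/S; lra.
have Ui := U0 i vi.
pose t := (U i)^-1.
have t0 : 0 < t by rewrite invr_gt0.
have vb : 0 < bil R' (v i) (v i) by exact: pR'.2.
have v2 : 0 < bil (R' *m R') (v i) (v i) by exact: R2pos.
pose th := t * bil R' (v i) (v i).
have th1 : 0 < 1 - th.
  rewrite subr_gt0 /th /t mulrC ltr_pdivrMr// mul1r /U ltrDr divr_gt0//.
exists t, i; rewrite -/M'.
have -> : (row i O)^T *m row i O = v i *m (v i)^T by rewrite /v trmxK.
set M'' := M' - _.
have pM'' : posdef M''.
  split.
    by rewrite /M'' linearB/= linearZ/= trmx_mul trmxK pM'.1.
  move=> x x0; rewrite /M'' bilDm -scaleNr bilZm bil_outer -expr2 mulNr subr_gt0.
  set b := bil R' _ _ in vb *; set a := _ 0 0.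
  (* Completing the square in the form of [M'] gives the Cauchy-Schwarz bound a^2 <= M'(x,x) b;
     positivity then follows from [th < 1]. *)
  pose c := a / b.
  have := posdef_ge0 (x + (- c) *: (R' *m v i)) pM'.
  rewrite bilDl !bilDr !bilZl !bilZr.
  have e1 : bil M' x (R' *m v i) = a.
    rewrite bilC ?pM'.1// /bil trmx_mul pR'.1 -!mulmxA [R' *m _]mulmxA mulVmx// mul1mx//.
  have e2 : bil M' (R' *m v i) x = a by rewrite bilC ?pM'.1.
  have e3 : bil M' (R' *m v i) (R' *m v i) = b.
    by rewrite /b /bil trmx_mul pR'.1 -!mulmxA [M' *m _]mulmxA mulmxV// mul1mx.
  rewrite e1 e2 e3 => h.
  have xM := pM'.2 _ x0.
  have h2 : a ^+ 2 / b <= bil M' x x.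
    have -> : a ^+ 2 / b = 2 * c * a - c ^+ 2 * b by rewrite /c; field; rewrite lt0r_neq0.
    lra.
  have h3 : a ^+ 2 <= bil M' x x * b by rewrite -ler_pdivrMr.
  have h4 : t * a ^+ 2 <= bil M' x x * th.
    by rewrite /th [leRHS]mulrCA ler_pM2l.
  apply: (le_lt_trans h4); rewrite gtr_pMr//; lra.
split => //.
  by rewrite /t mulrCA -ler_pdivrMl ?invr_gt0// invrK mulrC.
(* The Sherman-Morrison formula. *)
have invE : invmx M'' = R' + (t / (1 - th)) *: (R' *m v i *m (v i)^T *m R').
  set X := R' + _.
  suff h : M'' *m X = 1%:M.
    by rewrite -[LHS]mulmx1 -h mulmxA mulVmx ?mul1mx//; exact: posdef_unit.
  have hv : M'' *m (R' *m v i) = (1 - th) *: v i.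
    rewrite /M'' mulmxBl mulmxA mulmxV// mul1mx -scalemxAl -mulmxA scalerBl scale1r.
    congr (_ - _); rewrite /th -scalerA; congr (_ *: _).
    by rewrite [(v i)^T *m _]mx11_scalar mul_mx_scalar /bil mulmxA.
  rewrite /X mulmxDr -scalemxAr !mulmxA -[M'' *m R' *m v i]mulmxA hv.
  rewrite -!scalemxAl scalerA divfK ?lt0r_neq0//.
  by rewrite /M'' mulmxBl mulmxV// -scalemxAl subrK.
rewrite invE linearD/= linearZ/= mxtrace_mulC !mulmxA.
have -> : \tr (R' *m R' *m v i *m (v i)^T) = bil (R' *m R') (v i) (v i).
  by rewrite mxtrace_mulC /bil !mulmxA /mxtrace big_ord1.
have -> : t / (1 - th) * bil (R' *m R') (v i) (v i) = D.
  have -> : 1 - th = t * (bil (R' *m R') (v i) (v i) / D).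
    by rewrite /th -[X in X - _](mulVf (lt0r_neq0 Ui)) -/t -mulrBr /U addrK.
  by field; rewrite !lt0r_neq0.
by rewrite /D addrC subrK.
Qed.

End quadratic_forms.
End barrier.

(** * Sparsification of tight frames, and monotonicity of Gaussian means in the covariance *)

Section finite_dim.
Context {R : realType}.

(* The barrier starts at [k] and moves to [2 k] in [k] steps, hence the rescaling at the end. *)
Lemma sparsify n k (O : 'M[R]_(n, k)) (p : 'rV[R]_k -> R) : seminorm p -> O^T *m O = 1%:M ->
  exists ys : seq 'rV[R]_k, [/\ size ys = k,
    forall phi : 'cV[R]_k, \sum_(y <- ys) (y *m phi) 0 0 ^+ 2 <= \sum_i phi i 0 ^+ 2 &
    \sum_i p (row i O) ^+ 2 <= 4 * \sum_(y <- ys) p y ^+ 2].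
Proof.
move=> sp OO; set S := \sum_i _.
have S0 : 0 <= S by apply: sumr_ge0 => i _; exact: sqr_ge0.
have [->|Sn0] := eqVneq S 0.
  exists (nseq k 0); split; first by rewrite size_nseq.
  - move=> phi; rewrite big1_seq ?sumr_ge0//; first by move=> i _; exact: sqr_ge0.
    by move=> y /andP[_ /nseqP[-> _]]; rewrite mul0mx mxE expr0n.
  - by rewrite mulr_ge0// sumr_ge0// => y _; exact: sqr_ge0.
have {S0 Sn0} S0 : 0 < S by rewrite lt0r Sn0.
have k0 : (0 < k)%N.
  case: k => // in O p sp OO S S0 *; exfalso; move: S0; rewrite /S big1 ?ltxx// => i _.
  by rewrite [row i O]thinmx0 (semi0 sp) expr0n.
have kR : (0 : R) < k%:R by rewrite ltr0n.
pose G ys : 'M[R]_k := \sum_(y <- ys) y^T *m (y : 'rV[R]_k).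
have step j : exists ys : seq 'rV[R]_k, [/\ size ys = j,
    posdef ((k + j)%:R%:M - G ys), \tr (invmx ((k + j)%:R%:M - G ys)) <= 1 &
    j%:R * S <= 2 * \sum_(y <- ys) p y ^+ 2].
  elim: j => [|j [ys [sz pM trM hS]]].
    exists [::]; split => //.
    - rewrite /G big_nil subr0 addn0; split; first by rewrite tr_scalar_mx.
      move=> x x0; rewrite -scalemx1 bilZm mulr_gt0// bil1 lt0r sumr_ge0 ?andbT; last first.
        by move=> i _; exact: sqr_ge0.
      apply: contra_neq x0 => /eqP; rewrite psumr_eq0; last by move=> i _; exact: sqr_ge0.
      move=> /allP h; apply/matrixP => i i'; rewrite !ord1 [RHS]mxE.
      by have := h i (mem_index_enum _); rewrite sqrf_eq0 => /eqP.
    - rewrite /G big_nil subr0 addn0 invmx_scalar mxtrace_scalar -[_^-1 *+ _]mulr_natr.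
      by rewrite mulVf ?lt0r_neq0.
    - by rewrite mul0r big_nil mulr0.
  have [||t [i [t0 hi pM' trM']]] := @barrier_step R k n O (fun i => p (row i O) ^+ 2) _ k0 OO _
    _ pM trM S0.
  - by move=> i; exact: sqr_ge0.
  - by move=> i ->; rewrite (semi0 sp) expr0n.
  exists (Num.sqrt t *: row i O :: ys).
  have GE : (k + j.+1)%:R%:M - G (Num.sqrt t *: row i O :: ys) =
      (k + j)%:R%:M - G ys + 1%:M - t *: ((row i O)^T *m row i O).
    have eT : (Num.sqrt t *: row i O)^T = Num.sqrt t *: (row i O)^T by rewrite linearZ.
    rewrite /G big_cons eT -scalemxAl -scalemxAr scalerA -expr2 sqr_sqrtr ?ltW//.
    rewrite addnS -addn1 natrD raddfD/= opprD addrA.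
    by rewrite addrAC; congr (_ - _); rewrite addrAC.
  rewrite GE; split => //=; first by rewrite sz.
  rewrite big_cons (semiZ_sqr sp) (sqr_sqrtr (ltW t0)) -[j.+1%:R]natr1 mulrDl mul1r mulrDr.
  by rewrite [leRHS]addrC; exact: lerD.
have [ys [sz [_ pM] _ hS]] := step k.
(* After [k] steps [G ys] lies below 2k times the identity and the sum of the [p y ^+ 2] is at least
   k S / 2. Dividing by c^2 = 2k normalises the first bound and leaves S / 4 in the second. *)
have c0 : 0 < Num.sqrt ((k + k)%:R : R) by rewrite sqrtr_gt0 ltr0n addn_gt0 k0.
have c2 : Num.sqrt ((k + k)%:R : R) ^+ 2 = (k + k)%:R by rewrite sqr_sqrtr.
set c := Num.sqrt _ in c0 c2.
exists [seq c^-1 *: y | y <- ys]; split; first by rewrite size_map.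
- move=> phi; rewrite big_map.
  have -> : \sum_(y <- ys) ((c^-1 *: y) *m phi) 0 0 ^+ 2 = c ^- 2 * bil (G ys) phi phi.
    rewrite /G; elim: ys {sz pM hS} => [|y ys IH].
      by rewrite !big_nil /bil mulmx0 mul0mx mxE mulr0.
    rewrite !big_cons bilDm mulrDr IH; congr (_ + _).
    have := bil_outer y^T phi phi; rewrite trmxK => ->.
    by rewrite -scalemxAl mxE exprMn exprVn expr2.
  rewrite mulrC ler_pdivrMr ?exprn_gt0// c2 mulrC -bil1.
  have [->|/pM] := eqVneq phi 0; first by rewrite /bil !mulmx0 mxE mulr0.
  by rewrite bilDm -scaleN1r bilZm mulN1r subr_gt0 -scalemx1 bilZm => /ltW.
- rewrite big_map.
  under eq_bigr do rewrite (semiZ_sqr sp).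
  rewrite -mulr_sumr exprVn c2.
  rewrite mulrCA ler_pdivlMl ?ltr0n ?addn_gt0 ?k0// natrD; lra.
Qed.

(** Gram-Schmidt on the columns: the first column is orthogonalised against the factor of the
    others, and a zero residue adds no column. Thus [k] can be smaller than [d] when the rows do not
    span. *)
Lemma orthonormal_factor n d (X : 'M[R]_(n, d)) :
  exists k (O : 'M[R]_(n, k)) (T : 'M[R]_(k, d)), [/\ (k <= d)%N, O^T *m O = 1%:M & X = O *m T].
Proof.
elim: d X => [|d IH] X.
  exists 0%N, (0 : 'M[R]_(n, 0)), (0 : 'M[R]_(0, 0)); split => //;
    first by rewrite [LHS]flatmx0 [RHS]flatmx0.
  by rewrite [LHS]thinmx0 [RHS]thinmx0.
pose c := @lsubmx R n 1 d X; pose X1 := @rsubmx R n 1 d X.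
have [k [Q [T [kd OO XE]]]] := IH X1.
have XX : X = row_mx c X1 :> 'M[R]_(n, 1 + d) by rewrite hsubmxK.
pose c' := c - Q *m (Q^T *m c).
have Oc : Q^T *m c' = 0 by rewrite /c' mulmxBr (mulmxA Q^T Q) OO mul1mx subrr.
have cE : c = Q *m (Q^T *m c) + c' by rewrite /c' addrC subrK.
have [c0|c0] := eqVneq c' 0.
  exists k, Q, (row_mx (Q^T *m c) T : 'M[R]_(k, 1 + d)); split => //; first exact: leqW.
  rewrite [LHS]XX; apply: (etrans _ (esym (mul_mx_row Q (Q^T *m c) T))).
  by rewrite -XE; congr row_mx; rewrite [LHS]cE c0 addr0.
pose s := \sum_i c' i 0 ^+ 2.
have s0 : 0 < s.
  rewrite lt0r sumr_ge0 ?andbT; last by move=> i _; exact: sqr_ge0.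
  apply: contra_neq c0 => /eqP; rewrite psumr_eq0; last by move=> i _; exact: sqr_ge0.
  move=> /allP h; apply/matrixP => i i'; rewrite !ord1 [RHS]mxE.
  by have := h i (mem_index_enum _); rewrite sqrf_eq0 => /eqP.
have ss : c'^T *m c' = s%:M.
  apply/matrixP => i j; rewrite !ord1 !mxE eqxx mulr1n; apply: eq_bigr => l _.
  by rewrite mxE.
pose r := Num.sqrt s.
have r0 : r != 0 by rewrite lt0r_neq0// sqrtr_gt0.
have r2 : r ^+ 2 = s by rewrite sqr_sqrtr// ltW.
exists (k + 1)%N, (row_mx Q (r^-1 *: c')), (block_mx (Q^T *m c) T r%:M 0 : 'M[R]_(k + 1, 1 + d)).
split; first by rewrite addn1.
- have eT : (r^-1 *: c')^T = r^-1 *: c'^T by rewrite linearZ.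
  rewrite tr_row_mx mul_col_row OO eT -scalemxAr Oc scaler0 -!scalemxAl.
  have -> : c'^T *m Q = 0 by rewrite -[LHS]trmxK trmx_mul trmxK Oc trmx0.
  rewrite scaler0 -scalemxAr ss scalerA -invrM ?unitfE// -expr2 r2 scale_scalar_mx mulVf
    ?lt0r_neq0//.
  by rewrite -scalar_mx_block.
- rewrite [LHS]XX; apply: (etrans _ (esym (mul_row_block Q _ (Q^T *m c) T r%:M 0))).
  rewrite -XE mulmx0 addr0; congr row_mx.
  by rewrite -scalemxAl mul_mx_scalar scalerA mulVf// scale1r.
Qed.

Lemma additive_form_mx k (phi : 'rV[R]_k -> R) : additive_form phi ->
  exists c : 'cV[R]_k, forall v, phi v = (v *m c) 0 0.
Proof.
move=> hphi.
have phi0 : phi 0 = 0 by have := hphi 1 0 0; rewrite scale1r addr0 mul1r; lra.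
exists (\col_i phi (delta_mx 0 i)) => v.
rewrite {1}(row_sum_delta v) mxE.
elim: (index_enum _) => [|i s IH]; first by rewrite !big_nil phi0.
by rewrite !big_cons hphi IH; congr (_ * _ + _); rewrite mxE.
Qed.

Lemma mx_additive_form k (c : 'cV[R]_k) : additive_form (fun v : 'rV[R]_k => (v *m c) 0 0).
Proof. by move=> a v w; rewrite mulmxDl -scalemxAl !mxE. Qed.

(* With [M := X^T X], domination forces [y = f M], and [f X^T] are the coefficients. *)
Lemma dominated_comb n k (X : 'M[R]_(n, k)) (y : 'rV[R]_k) :
  (forall c : 'cV[R]_k, (y *m c) 0 0 ^+ 2 <= \sum_i (row i X *m c) 0 0 ^+ 2) ->
  exists2 a : 'rV[R]_n, y = a *m X & \sum_i a 0 i ^+ 2 <= 1.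
Proof.
move=> h; pose M := X^T *m X.
have hM (c : 'cV[R]_k) : \sum_i (row i X *m c) 0 0 ^+ 2 = (c^T *m M *m c) 0 0.
  rewrite /M mulmxA -mulmxA -trmx_mul mxE; apply: eq_bigr => i _.
  by rewrite -row_mul !mxE expr2.
(* The columns of [cokermx M] are annihilated by [M], hence by [y] because of the domination. *)
have /submxP[f yf] : (y <= M)%MS.
  rewrite submxE; apply/eqP/matrixP => i j; rewrite !ord1 [RHS]mxE.
  pose c := cokermx M *m delta_mx j 0 : 'cV[R]_k.
  have -> : (y *m cokermx M) 0 j = (y *m c) 0 0. 
    by rewrite /c [in RHS](mulmxA y (cokermx M)) -[in RHS]colE [RHS]mxE.
  have := h c; rewrite hM -[_ *m M *m c]mulmxA [M *m c]mulmxA mulmx_coker mul0mx mulmx0.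
  rewrite [X in _ <= X]mxE => hle.
  have : (y *m c) 0 0 ^+ 2 = 0 by apply/eqP; rewrite eq_le hle sqr_ge0.
  by move/eqP; rewrite sqrf_eq0 => /eqP.
exists (f *m X^T); first by rewrite -mulmxA.
have e : \sum_i (f *m X^T) 0 i ^+ 2 = (f *m M *m f^T) 0 0.
  rewrite /M mulmxA -mulmxA mxE; apply: eq_bigr => i _; rewrite expr2; congr (_ * _).
  have -> : X *m f^T = (f *m X^T)^T by rewrite trmx_mul trmxK.
  by rewrite [RHS]mxE.
(* At [f^T] the domination reads b^2 <= b, where [b] is the sum of squares of the coefficients. *)
have := h f^T; rewrite hM trmxK -yf e -yf.
set b := _ 0 0 => hb.
have [b0|b0] := lerP b 0; first by apply: (le_trans b0).
by move: hb; rewrite expr2 -subr_ge0 -[X in X - _]mul1r -mulrBl pmulr_lge0// subr_ge0.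
Qed.

(** Induction on [ys]. Domination makes [y] a combination of [xs] with coefficients in the Euclidean
    unit ball, and after alignment [y = c *: u] with c <= 1. The rest of [u] returns to the list,
    which still dominates the remaining [ys]; vectors left at the end only increase a convex
    mean. *)
Lemma heats_mono k (p : 'rV[R]_k -> R) f xs ys z : seminorm p -> quad_lipschitz p f -> convex_fun
  f ->
  (forall phi, additive_form phi -> sumform ys phi <= sumform xs phi) ->
  heats ys f z <= heats xs f z.
Proof.
move=> sp qf cf; elim: ys xs z => [|y ys IH] xs z hxy; first exact: (heats_ge sp).
have [l [hl yl l1]] : exists l, [/\ unzip2 l = xs, comb l = y & sumsq l <= 1].
  pose X := \matrix_(i < size xs) tnth (in_tuple xs) i.
  have rX i : row i X = tnth (in_tuple xs) i by rewrite rowK.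
  have [c|a ya a1] := @dominated_comb _ _ X y.
    have := hxy _ (mx_additive_form c); rewrite /sumform big_cons [X in _ <= X]big_tnth => h.
    under eq_bigr do rewrite rX.
    by apply: le_trans h; rewrite lerDl; apply: sumr_ge0 => i _; exact: sqr_ge0.
  exists [seq (a 0 i, tnth (in_tuple xs) i) | i <- enum 'I_(size xs)]; split.
  - by rewrite /unzip2 -map_comp -[RHS](map_tnth_enum (in_tuple xs)).
  - rewrite /comb big_map/= big_enum/= ya mulmx_sum_row.
    by apply: eq_bigr => i _; rewrite rX.
  - by rewrite /sumsq big_map/= big_enum.
have [l0|l0] := eqVneq (sumsq l) 0.
  rewrite /= -yl (comb0 l0) heat0; apply: IH => phi hphi; apply: le_trans (hxy _ hphi).
  by rewrite /sumform big_cons lerDr sqr_ge0.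
have {l0}l0 : 0 < sumsq l by rewrite lt0r l0 sumsq_ge0.
have [u [xs' [hu hheat hform]]] := heats_align sp l0.
pose c := Num.sqrt (sumsq l); pose s := Num.sqrt (1 - sumsq l).
have cs : c ^+ 2 + s ^+ 2 = 1 by rewrite !sqr_sqrtr ?subr_ge0// ?ltW// addrC subrK.
have yu : y = c *: u by rewrite -yl -hu.
rewrite -hl -hheat//=.
have qx := quad_heats sp xs' qf.
(* Rotating the pair [(u, 0)] splits [heat u] into averages along [c *: u], that is [y], and
   [- s *: u]. *)
rewrite -[heat u _](_ : heat y (heat (- s *: u) (heats xs' f)) = _); last first.
  have := heat_rot sp u 0 qx cs; rewrite !scaler0 !addr0 heat0 -yu => ->.
  by [].
apply: (le_heat sp).
- exact: (quad_heats sp).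
- exact: (quad_heats sp (- s *: u :: xs')).
move=> z'; apply: (IH (- s *: u :: xs')) => phi hphi.
have := hxy _ hphi; rewrite -hl -hform// /sumform !big_cons yu.
have phi0 : phi 0 = 0 by have := hphi 1 0 0; rewrite scale1r addr0 mul1r; lra.
have phiZ b v : phi (b *: v) = b * phi v by have := hphi b v 0; rewrite !addr0 phi0 addr0.
have e : phi u ^+ 2 = (c * phi u) ^+ 2 + (- s * phi u) ^+ 2 by rewrite !exprMn sqrrN -mulrDl cs
  mul1r.
by rewrite !phiZ e; lra.
Qed.

End finite_dim.

Section few_vectors.
Context {R : realType}.

Lemma rad_map (V W : lmodType R) (g : V -> W) (f : W -> R) xs z :
  (forall v w, g (v + w) = g v + g w) -> (forall v, g (- v) = - g v) ->
  rad [seq g x | x <- xs] f (g z) = rad xs (fun v => f (g v)) z.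
Proof.
move=> gD gN; elim: xs z => //= x xs IH z.
by rewrite -gN -!gD !IH.
Qed.

(** In the coordinates of the orthonormal factor three comparisons are chained: signs with Gaussians
    on [zs], at the price of [kappa]; Gaussians on [zs] with Gaussians on [os], by covariance;
    Gaussians with signs on [os], by clipping. The level [T] stays free, to be balanced against the
    dimension. *)
Lemma few_vectors d (p : 'rV[R]_d -> R) xs (T : R) : seminorm p -> 0 < T ->
  exists ys, [/\ (size ys <= d)%N,
    \sum_(x <- xs) p x ^+ 2 <= 4 * \sum_(y <- ys) p y ^+ 2 &
    kappa ^+ 2 * rad ys (fun v => p v ^+ 2) 0 <=
      2 * rad xs (fun v => p v ^+ 2) 0 * (T ^+ 2 + clip_tail_cst * expR (- T ^+ 2 / 4) * d%:R)].
Proof.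
move=> sp T0.
pose n := size xs.
pose X := \matrix_(i < n) tnth (in_tuple xs) i.
have rX i : row i X = tnth (in_tuple xs) i by rewrite rowK.
have xsE : xs = [seq row i X | i <- enum 'I_n].
  by rewrite -[LHS](map_tnth_enum (in_tuple xs)); apply: eq_map => i; rewrite rX.
have [k [Q [A [kd QQ XE]]]] := orthonormal_factor X.
pose p' (v : 'rV[R]_k) := p (v *m A).
have sp' : seminorm p'.
  by split => [v w|a v]; rewrite /p' ?mulmxDl -?scalemxAl; [exact: sp.1|exact: sp.2].
have gD (v w : 'rV[R]_k) : (v + w) *m A = v *m A + w *m A by exact: mulmxDl.
have gN (v : 'rV[R]_k) : (- v) *m A = - (v *m A) by exact: mulNmx.
pose os := [seq row i Q | i <- enum 'I_n].
have osE : xs = [seq v *m A | v <- os].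
  by rewrite [LHS]xsE /os -[in RHS]map_comp; apply: eq_map => i /=; rewrite XE row_mul.
have [zs [sz hz hS]] := sparsify sp' QQ.
exists [seq z *m A | z <- zs]; split; first by rewrite size_map sz.
  by rewrite osE 2!big_map big_enum/= big_map.
pose rho := rad xs (fun v => p v ^+ 2) 0.
have rhoE : rad os (fun v => p' v ^+ 2) 0 = rho.
  by rewrite /rho osE -(mul0mx _ A) (rad_map _ _ _ gD gN).
have rho0 : 0 <= rho by apply: rad_ge0 => v; exact: sqr_ge0.
rewrite -/rho -{1}(mul0mx _ A) (rad_map (fun v => p v ^+ 2) zs 0 gD gN).
rewrite -/p' -(@rad_scale R _ p' sp' kappa zs 0) scaler0.
have q' := quad_sqr sp'; have c' := convex_semi_sqr sp'.
apply: (le_trans (rad_le_heats sp' zs 0 q' c')).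
have hmono : forall phi, additive_form phi -> sumform zs phi <= sumform os phi.
  move=> phi /additive_form_mx [c hc]; rewrite /sumform.
  under eq_bigr do rewrite hc.
  apply: (le_trans (hz c)); rewrite /os big_map big_enum/=.
  have -> : \sum_i c i 0 ^+ 2 = ((Q *m c)^T *m (Q *m c)) 0 0.
    rewrite trmx_mul -mulmxA [Q^T *m _]mulmxA QQ mul1mx mxE.
    by apply: eq_bigr => i _; rewrite mxE expr2.
  rewrite mxE le_eqVlt; apply/orP; left; apply/eqP; apply: eq_bigr => i _.
  by rewrite hc -row_mul !mxE expr2.
apply: (le_trans (heats_mono 0 sp' q' c' hmono)).
pose dot (v w : 'rV[R]_k) := (v *m w^T) 0 0.
have dotC v w : dot v w = dot w v.
  by rewrite /dot tr_scalar_mx1 trmx_mul trmxK.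
have hdot v x (t : R) : dot (v + t *: x) (v + t *: x) = dot v v + 2 * t * dot v x + t ^+ 2 * dot
  x x.
  have dDl a b c : dot (a + b) c = dot a c + dot b c by rewrite /dot mulmxDl mxE.
  have dZl a b c : dot (a *: b) c = a * dot b c by rewrite /dot -scalemxAl mxE.
  rewrite !dDl !(dotC _ (v + _)) !dDl !dZl !(dotC _ (t *: x)) !dZl (dotC x v); ring.
(* The tight frame reproduces [v] from the coefficients [dot v (row i Q)], whose squares sum to
   [dot v v]; duality then gives the Euclidean bound on [p']. *)
have prho v : p' v ^+ 2 <= rho * dot v v.
  pose l := [seq (dot v (row i Q), row i Q) | i <- enum 'I_n].
  have := comb_le_rad sp' l 0 0.
  have -> : unzip2 l = os by rewrite /unzip2 /l -map_comp.
  rewrite rhoE scaler0 add0r expr0n add0r.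
  have -> : comb l = v.
    rewrite /comb /l big_map big_enum/=.
    rewrite -[RHS]mulmx1 -QQ mulmxA mulmx_sum_row; apply: eq_bigr => i _; congr (_ *: _).
    by rewrite /dot !mxE; apply: eq_bigr => j _; rewrite !mxE.
  have -> : sumsq l = dot v v.
    rewrite /sumsq /l big_map big_enum/=.
    have -> : dot v v = (v *m Q^T *m (v *m Q^T)^T) 0 0.
      by rewrite /dot trmx_mul trmxK mulmxA -(mulmxA v) QQ mulmx1.
    rewrite [RHS]mxE; apply: eq_bigr => i _.
    have -> : dot v (row i Q) = (v *m Q^T) 0 i.
      by rewrite /dot !mxE; apply: eq_bigr => j _; rewrite !mxE.
    by rewrite [X in _ = _ * X]mxE expr2.
  by rewrite mulrC.
have := @heats_le_rad R _ p' sp' dot rho T os 0 0 rho0 T0 prho hdot.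
rewrite addr0 => /le_trans; apply.
have -> : dot 0 0 = 0 by rewrite /dot mul0mx mxE.
have -> : rad [seq T *: x | x <- os] (fun v => p' v ^+ 2) 0 = T ^+ 2 * rho.
  by rewrite -(scaler0 _ T) rad_scale// rhoE.
have -> : \sum_(x <- os) dot x x = k%:R.
  rewrite /os big_map big_enum/= -[RHS](mxtrace1 R k) -QQ mxtrace_mulC.
  by apply: eq_bigr => i _; rewrite /dot tr_row !mxE; apply: eq_bigr => j _; rewrite !mxE.
rewrite add0r [leRHS]mulrDr; apply: lerD; first by rewrite [T ^+ 2 * rho]mulrC mulrA.
rewrite ler_wpM2l ?mulr_ge0//; apply: ler_pM => //.
- by apply: gauss_mean_ge0 => t; exact: sqr_ge0.
- by apply: gauss_mean_tail; exact: ltW.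
- by rewrite ler_nat.
Qed.

End few_vectors.

(** * From few vectors to all vectors *)

Section cotype_tail.
Context {R : realType}.

(** Hölder's inequality up to a factor 2: every a^2 is at most t^2 + t^(2-q) a^q, and for t = B
    d^(-1/q) each of the two terms sums to at most d t^2. *)
Lemma sum_sqr_le (s : seq R) (d : nat) (B q : R) : (0 < d)%N -> 2 < q -> 0 <= B ->
  (forall a, a \in s -> 0 <= a) -> (size s <= d)%N -> \sum_(a <- s) a `^ q <= B `^ q ->
  \sum_(a <- s) a ^+ 2 <= 2 * d%:R `^ (1 - 2 / q) * B ^+ 2.
Proof.
move=> d0 q2 B0 s0 sd hs.
have q0 : 0 < q by lra.
have dR : 0 < d%:R :> R by rewrite ltr0n.
have [Bz|Bn0] := eqVneq B 0.
  rewrite Bz expr0n mulr0 big1_seq// => a /andP[_ as_].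
  move: hs; rewrite Bz powR0 ?lt0r_neq0// => hs.
  have : \sum_(b <- s) b `^ q == 0.
    by rewrite eq_le hs sumr_ge0// => b _; exact: powR_ge0.
  rewrite psumr_eq0; last by move=> b _; exact: powR_ge0.
  by move=> /allP/(_ a as_); rewrite /= powR_eq0 => /andP[/eqP -> _]; rewrite expr0n.
have {B0 Bn0} B0 : 0 < B by rewrite lt0r Bn0.
pose t := B * d%:R `^ (- q^-1).
have t0 : 0 < t by rewrite mulr_gt0// powR_gt0.
have tq : t `^ q = B `^ q / d%:R.
  rewrite powRM ?powR_ge0 ?ltW// -powRrM mulNr mulVf ?lt0r_neq0//.
  by rewrite powR_inv1// ltW.
have t2 : t ^+ 2 = B ^+ 2 * d%:R `^ (- (2 / q)).
  rewrite exprMn -[(_ `^ (- q^-1)) ^+ 2]powR_mulrn ?powR_ge0// -powRrM.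
  by congr (_ * _ `^ _); field; rewrite lt0r_neq0.
have tpos : 0 < t `^ (2 - q) by rewrite powR_gt0.
have hq : t `^ (2 - q) * t `^ q = t ^+ 2.
  rewrite -powRD; last by rewrite (lt0r_neq0 t0) implybT.
  by rewrite subrK powR_mulrn// ltW.
have key a : a \in s -> a ^+ 2 <= t ^+ 2 + t `^ (2 - q) * a `^ q.
  move=> /s0 a0; have [at_|ta] := lerP a t.
    apply: (@le_trans _ _ (t ^+ 2)); first by rewrite ler_sqr ?nnegrE// ltW.
    by rewrite lerDl mulr_ge0 ?powR_ge0.
  have a1 : 0 < a by apply: lt_trans ta.
  apply: (@le_trans _ _ (t `^ (2 - q) * a `^ q)); last by rewrite lerDr sqr_ge0.
  have -> : a ^+ 2 = a `^ (2 - q) * a `^ q.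
    rewrite -powRD; last by rewrite (lt0r_neq0 a1) implybT.
    by rewrite subrK powR_mulrn// ltW.
  rewrite ler_wpM2r ?powR_ge0// -[2 - q]opprB !powRN lef_pV2 ?posrE ?powR_gt0//.
  by apply: ge0_ler_powR; rewrite ?nnegrE ?(ltW a1) ?(ltW t0) ?(ltW ta)//; lra.
have h1 : \sum_(a <- s) a ^+ 2 <= (size s)%:R * t ^+ 2 + t `^ (2 - q) * \sum_(a <- s) a `^ q.
  rewrite big_seq; apply: (le_trans (ler_sum _ key)); rewrite -big_seq big_split/= mulr_sumr.
  by rewrite big_const_seq count_predT iter_addr_0 -[_ ^+ 2 *+ _]mulr_natl.
apply: (le_trans h1); apply: (@le_trans _ _ (2 * (d%:R * t ^+ 2))).
  have -> : 2 * (d%:R * t ^+ 2) = d%:R * t ^+ 2 + d%:R * t ^+ 2 by ring.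
  apply: lerD; first by rewrite ler_wpM2r ?sqr_ge0// ler_nat.
  rewrite -hq tq; apply: (@le_trans _ _ (t `^ (2 - q) * B `^ q)).
    by rewrite ler_wpM2l// ltW.
  by rewrite mulrCA [d%:R * _]mulrC divfK ?lt0r_neq0.
rewrite t2 powRD ?(lt0r_neq0 dR) ?implybT// powRr1 ?ler0n//.
by rewrite le_eqVlt; apply/orP; left; apply/eqP; ring.
Qed.

(** The 4 lost in the selection, times the 2 of [sum_sqr_le], times the factor
    [2 * (4 + clip_tail_cst) / kappa ^+ 2] between the two Rademacher means. *)
Definition cotype_cst : R := 16 * (4 + clip_tail_cst) / kappa ^+ 2.

Lemma cotype_cst_ge0 : 0 <= cotype_cst.
Proof. by rewrite /cotype_cst divr_ge0 ?sqr_ge0// mulr_ge0// addr_ge0// clip_tail_cst_ge0. Qed.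

Variables (d : nat) (p : 'rV[R]_d -> R) (q K : R).
Hypotheses (sp : seminorm p) (d0 : (0 < d)%N) (q2 : 2 < q) (K0 : 0 <= K).
Let sqp : 'rV[R]_d -> R := fun v => p v ^+ 2.

Lemma ln_nat_ge0 (n : nat) : 0 <= ln (n%:R : R).
Proof.
case: n => [|n]; first by rewrite ln0.
by apply: ln_ge0; rewrite ler1n.
Qed.

Lemma sum_sqr_le_rad xs :
  (forall ys, (size ys <= d)%N -> \sum_(y <- ys) p y `^ q <= K `^ q * (rad ys sqp 0) `^ (q / 2)) ->
  \sum_(x <- xs) p x ^+ 2 <=
    cotype_cst * (1 + ln d%:R) * d%:R `^ (1 - 2 / q) * K ^+ 2 * rad xs sqp 0.
Proof.
move=> hK; set L := 1 + ln _; set D := _ `^ (1 - 2 / q).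
have L1 : 1 <= L by rewrite lerDl ln_nat_ge0.
have dR : 0 < d%:R :> R by rewrite ltr0n.
(* With this level the tail factor exp(-T^2/4) d equals exp(-1), so the dimension disappears from
   it. *)
pose T : R := Num.sqrt (4 * L).
have T0 : 0 < T by rewrite sqrtr_gt0; lra.
have T2 : T ^+ 2 = 4 * L by rewrite sqr_sqrtr//; lra.
have [ys [sz hS hr]] := few_vectors xs sp T0.
set rho := rad xs sqp 0.
have rho0 : 0 <= rho by apply: rad_ge0 => v; exact: sqr_ge0.
set r := rad ys sqp 0 in hr.
have r0 : 0 <= r by apply: rad_ge0 => v; exact: sqr_ge0.
have k2 : 0 < kappa ^+ 2 :> R by rewrite exprn_gt0// kappa_gt0.
have eT : expR (- T ^+ 2 / 4) * d%:R <= 1.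
  have -> : - T ^+ 2 / 4 = - 1 - ln d%:R by rewrite T2 /L; field.
  rewrite expRD [expR (- ln _)]expRN lnK ?posrE// divfK ?(lt0r_neq0 dR)//.
rewrite T2 in eT hr.
have hr2 : r <= 2 * (4 + clip_tail_cst) * L / kappa ^+ 2 * rho.
  rewrite mulrAC ler_pdivlMr// mulrC; apply: (le_trans hr); rewrite -/rho -mulrA.
  have -> : 2 * (4 + clip_tail_cst) * L * rho = 2 * (rho * (4 * L + clip_tail_cst * L)) by ring.
  rewrite ler_wpM2l// ler_wpM2l// lerD2l -mulrA ler_wpM2l ?clip_tail_cst_ge0//.
  exact: le_trans eT L1.
pose B := K * Num.sqrt r.
have B2 : B ^+ 2 = K ^+ 2 * r by rewrite exprMn sqr_sqrtr.
have Bq : B `^ q = K `^ q * r `^ (q / 2).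
  by rewrite powRM ?sqrtr_ge0// -powR12_sqrt// -powRrM [2^-1 * q]mulrC.
have := @sum_sqr_le [seq p y | y <- ys] d B q d0 q2.
rewrite !big_map size_map Bq B2 => h.
have {}h : \sum_(y <- ys) p y ^+ 2 <= 2 * D * (K ^+ 2 * r).
  apply: h => //; last exact: hK.
    by rewrite mulr_ge0// sqrtr_ge0.
  by move=> _ /mapP[y _ ->]; exact: semi_ge0.
apply: (le_trans hS).
have D0 : 0 <= D by exact: powR_ge0.
apply: (@le_trans _ _ (4 * (2 * D * (K ^+ 2 * (2 * (4 + clip_tail_cst) * L / kappa ^+ 2 * rho))))).
  rewrite ler_wpM2l//; apply: (le_trans h).
  apply: ler_wpM2l; first by rewrite mulr_ge0.
  by apply: ler_wpM2l; first exact: sqr_ge0.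
rewrite /cotype_cst le_eqVlt; apply/orP; left; apply/eqP; field.
by rewrite lt0r_neq0// kappa_gt0.
Qed.

Lemma cotype_from_few (m : nat) xs : (d <= m)%N ->
  (forall ys, (size ys <= m)%N -> \sum_(y <- ys) p y `^ q <= K `^ q * (rad ys sqp 0) `^ (q / 2)) ->
  cotype_cst * (1 + ln d%:R) * (d%:R / m%:R) `^ (1 - 2 / q) <= 3 ->
  rad xs sqp 0 <= 1 -> \sum_(x <- xs) p x `^ q <= 4 * K `^ q.
Proof.
move=> dm hK hm hx; have q2' := q2.
have q0 : 0 < q by lra.
have cs : convex_fun sqp := convex_semi_sqr sp.
have sq0 v : 0 <= sqp v by exact: sqr_ge0.
have mR : 0 < m%:R :> R by rewrite ltr0n (leq_trans d0).
have dR : 0 < d%:R :> R by rewrite ltr0n.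
pose t := K * m%:R `^ (- q^-1).
have t0 : 0 <= t by rewrite mulr_ge0 ?powR_ge0.
have tq : t `^ q = K `^ q / m%:R.
  by rewrite powRM ?powR_ge0// -powRrM mulNr mulVf ?lt0r_neq0// powR_inv1// ltW.
have hK1 ys : (size ys <= m)%N -> rad ys sqp 0 <= 1 -> \sum_(y <- ys) p y `^ q <= K `^ q.
  move=> sy ry; apply: (le_trans (hK _ sy)); rewrite ler_piMr ?powR_ge0//.
  have e1 : (1 : R) `^ (q / 2) = 1 by rewrite powR1.
  rewrite -[leRHS]e1; apply: ge0_ler_powR; rewrite ?nnegrE ?rad_ge0//.
  by rewrite divr_ge0// ltW.
pose big := [seq x <- xs | t < p x].
have rbig : rad big sqp 0 <= 1 by apply: le_trans hx; exact: rad_filter_le.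
(* Otherwise [m] of these vectors would have a sum of [q]-th powers above m t^q = K^q. *)
have sbig : (size big <= m)%N.
  rewrite leqNgt; apply/negP => mb.
  have st : size (take m big) = m by rewrite size_takel// ltnW.
  have := hK1 (take m big); rewrite st => /(_ (leqnn _)).
  have -> : rad (take m big) sqp 0 <= 1.
    by apply: le_trans rbig; rewrite -{2}(cat_take_drop m big); exact: rad_cat_le.
  move=> /(_ isT); apply/negP; rewrite -ltNge.
  have -> : K `^ q = \sum_(y <- take m big) t `^ q.
    by rewrite big_const_seq count_predT iter_addr_0 st tq -[_ / _ *+ _]mulr_natr divfK ?lt0r_neq0.
  have hlt y : y \in take m big -> t `^ q < p y `^ q.
    move=> /mem_take; rewrite mem_filter => /andP[ty _].
    by apply: gt0_ltr_powR; rewrite ?nnegrE// (semi_ge0 sp).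
  case E : (take m big) st => [|y0 l] st; first by move: mR; rewrite -st ltxx.
  rewrite E in hlt; rewrite !big_cons; apply: ltr_leD; first by apply: hlt; rewrite mem_head.
  rewrite big_seq [leRHS]big_seq; apply: ler_sum => y yl; apply: ltW; apply: hlt.
  by rewrite in_cons yl orbT.
have hbig := hK1 _ sbig rbig.
have -> : \sum_(x <- xs) p x `^ q = \sum_(x <- big) p x `^ q + \sum_(x <- xs | ~~ (t < p x)) p x
  `^ q.
  by rewrite big_filter [LHS](bigID (fun x => t < p x)).
have -> : 4 * K `^ q = K `^ q + 3 * K `^ q by ring.
apply: lerD => //.
have hsm x : ~~ (t < p x) -> p x `^ q <= t `^ (q - 2) * p x ^+ 2.
  rewrite -leNgt => px; have p0 := semi_ge0 sp x.
  have -> : p x `^ q = p x `^ (q - 2) * p x ^+ 2.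
    rewrite -powR_mulrn// -powRD ?subrK//; apply/implyP => /eqP; lra.
  rewrite ler_wpM2r ?sqr_ge0//; apply: ge0_ler_powR; rewrite ?nnegrE//; lra.
apply: (le_trans (ler_sum _ hsm)).
rewrite -mulr_sumr.
have h2 : \sum_(x <- xs | ~~ (t < p x)) p x ^+ 2 <=
    cotype_cst * (1 + ln d%:R) * d%:R `^ (1 - 2 / q) * K ^+ 2.
  apply: (@le_trans _ _ (\sum_(x <- xs) p x ^+ 2)).
    rewrite [leRHS](bigID (fun x => t < p x))/= lerDr; apply: sumr_ge0 => x _; exact: sqr_ge0.
  have := sum_sqr_le_rad xs (fun ys sy => hK ys (leq_trans sy dm)).
  move=> /le_trans; apply; rewrite ler_piMr//.
  have L0 : 0 <= 1 + ln (d%:R : R) by rewrite addr_ge0// ln_nat_ge0.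
  by rewrite mulr_ge0 ?sqr_ge0// mulr_ge0 ?powR_ge0// mulr_ge0 ?cotype_cst_ge0.
apply: (@le_trans _ _ (t `^ (q - 2) * (cotype_cst * (1 + ln d%:R) * d%:R `^ (1 - 2 / q) * K ^+ 2))).
  by rewrite ler_wpM2l ?powR_ge0.
apply: le_trans (ler_wpM2r (powR_ge0 K q) hm).
have -> : t `^ (q - 2) = K `^ (q - 2) * m%:R `^ (- (1 - 2 / q)).
  rewrite powRM ?powR_ge0// -powRrM; congr (_ * _ `^ _); field; lra.
have -> : K `^ q = K `^ (q - 2) * K ^+ 2.
  rewrite -powR_mulrn// -powRD ?subrK//; apply/implyP => /eqP; lra.
have -> : (d%:R / m%:R : R) `^ (1 - 2 / q) = d%:R `^ (1 - 2 / q) * m%:R `^ (- (1 - 2 / q)).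
  rewrite powRM ?invr_ge0 ?ltW//; congr (_ * _).
  by rewrite -powR_inv1 ?ltW// -powRrM mulN1r.
by rewrite le_eqVlt; apply/orP; left; apply/eqP; ring.
Qed.

End cotype_tail.

(** * Bernoulli sequences and Banach spaces *)

Section bernoulli_average.
Context {R : realType} {d : measure_display} {Omega : measurableType d}
  {mu : probability Omega R} (eps : nat -> {RV mu >-> R}).
Hypothesis beps : bernoulli_seq eps.
Context {V : lmodType R} (p : V -> R) (sp : seminorm p).

(** The signs are added one at a time: the function is continuous in the coefficient of the last
    vector and, by induction, measurable in the sample point for each fixed value of it. *)
Lemma measurable_eps_comb (z : V) (v : nat -> V) m :
  measurable_fun setT (fun w => p (z + \sum_(k < m) eps k w *: v k) ^+ 2).
Proof.
elim: m z => [|m IH] z.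
  have -> : (fun w : Omega => p (z + \sum_(k < 0) eps k w *: v k) ^+ 2) = (fun=> p z ^+ 2).
    by apply/funext => w; rewrite big_ord0 addr0.
  exact: measurable_cst.
pose F (s : R) (w : Omega) := p (z + s *: v m + \sum_(k < m) eps k w *: v k) ^+ 2.
have mF : measurable_fun setT (fun st : R * Omega => F st.1 st.2).
  apply: (@caratheodory_measurable R _ Omega F) => [w|s]; last exact: IH.
  have -> : F ^~ w = (fun s : R => p (z + \sum_(k < m) eps k w *: v k + s *: v m) ^+ 2).
    by apply/funext => s; rewrite /F addrAC.
  exact: (@quad_line_continuous R V p sp (fun u => p u ^+ 2) _ (v m) (quad_sqr sp)).
have := measurableT_comp mF (g := fun w => (eps m w, w)) _.
have -> : (fun st : R * Omega => F st.1 st.2) \o (fun w => (eps m w, w)) =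
    (fun w => p (z + \sum_(k < m.+1) eps k w *: v k) ^+ 2).
  by apply/funext => w; rewrite /= /F big_ord_recr/= addrAC addrA.
apply; apply: measurable_fun_pair; last exact: measurable_id.
exact: measurable_funPT.
Qed.

Let cyl (s : seq R) : set Omega :=
  \bigcap_(k in [set` iota 0 (size s)]) (eps k @^-1` [set nth 0 s k]).

Let sgn (s : seq R) := forall a, a \in s -> a = 1 \/ a = -1.

Let meas_eps k (a : R) : measurable (eps k @^-1` [set a]).
Proof. by rewrite -[X in measurable X]setTI; exact: measurable_funPT. Qed.

Let cyl_measurable s : measurable (cyl s).
Proof. by apply: fin_bigcap_measurable => [|k _]; [exact: finite_seq|exact: meas_eps]. Qed.

Let cyl_rcons s a : cyl (rcons s a) = cyl s `&` (eps (size s) @^-1` [set a]).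
Proof.
apply/seteqP; split => [w hw|w [hw ha]] /=.
  split => [k /=|].
    rewrite mem_iota/= add0n => ks; have := hw k;
      rewrite /= mem_iota size_rcons add0n ltnS (ltnW ks) => /(_ isT).
    by rewrite nth_rcons ks.
  have := hw (size s); rewrite /= mem_iota size_rcons add0n ltnS leqnn => /(_ isT).
  by rewrite nth_rcons ltnn eqxx.
move=> k /=; rewrite mem_iota size_rcons add0n ltnS => /andP[_];
  rewrite leq_eqVlt => /orP[/eqP ->|ks].
  by rewrite nth_rcons ltnn eqxx.
by rewrite nth_rcons ks; have := hw k; rewrite /= mem_iota add0n ks => /(_ isT).
Qed.

Let mu_cyl s : sgn s -> mu (cyl s) = ((2^-1) ^+ size s)%:E.
Proof.
move=> hs; rewrite beps.1; [|exact: iota_uniq|by move=> j; exact: measurable_set1].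
have -> : (\prod_(j <- iota 0 (size s)) mu (eps j @^-1` [set nth 0%R s j]) =
    \prod_(j <- iota 0 (size s)) (2^-1)%:E)%E.
  rewrite big_seq [RHS]big_seq; apply: eq_bigr => j; rewrite mem_iota add0n => /andP[_ js].
  by have [->|->] := hs _ (mem_nth 0 js); [exact: (beps.2 j).1|exact: (beps.2 j).2].
rewrite -[in RHS](size_iota 0 (size s)).
elim: (iota _ _) => [|k l IH]; first by rewrite big_nil expr0.
by rewrite big_cons IH -EFinM exprS.
Qed.

(** The two probabilities add up to one, so values other than 1 and -1 occur on a null set only. *)
Let mu_rest k : mu (~` (eps k @^-1` [set 1] `|` eps k @^-1` [set -1])) = 0%E.
Proof.
rewrite probability_setC; last exact: measurableU.
have AB0 : eps k @^-1` [set 1] `&` eps k @^-1` [set -1] = set0.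
  apply/seteqP; split => // w [/= -> /eqP]; rewrite -subr_eq0 opprK -mulr2n.
  by rewrite pnatr_eq0.
have -> : mu (eps k @^-1` [set 1] `|` eps k @^-1` [set -1]) = ((2^-1)%:E + (2^-1)%:E)%E.
  apply: (etrans (measureU mu (meas_eps k 1) (meas_eps k (-1)) AB0)).
  by congr (_ + _)%E; [exact: (beps.2 k).1|exact: (beps.2 k).2].
have -> : ((2^-1)%:E + (2^-1)%:E = 1 :> \bar R)%E by rewrite -EFinD; congr (_%:E); field.
by rewrite subee.
Qed.

(** Induction on the number [j] of undecided signs: up to a null set a cylinder is the disjoint
    union of its two extensions, and these match the two branches of [rad]. *)
Lemma integral_cyl (v : nat -> V) m j s : sgn s -> (size s + j)%N = m ->
  (\int[mu]_(w in cyl s) (p (\sum_(k < m) eps k w *: v k) ^+ 2)%:E)%E =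
  ((2^-1) ^+ size s * rad [seq v k | k <- iota (size s) j] (fun u => p u ^+ 2)
     (\sum_(k < size s) s`_k *: v k))%:E.
Proof.
set f := fun w => (p (\sum_(k < m) eps k w *: v k) ^+ 2)%:E.
have mf (D : set Omega) : measurable_fun D f.
  apply: measurable_funTS; apply/measurable_EFinP.
  have := measurable_eps_comb 0 v m.
  by under eq_fun do rewrite add0r.
have f0 w : (0 <= f w)%E by rewrite lee_fin sqr_ge0.
elim: j s => [|j IH] s hs sj.
  rewrite addn0 in sj.
  transitivity (\int[mu]_(w in cyl s) (p (\sum_(k < size s) s`_k *: v k) ^+ 2)%:E)%E.
    apply: eq_integral => w; rewrite inE => hw; rewrite /f -sj; congr (p _ ^+ 2)%:E.
    apply: eq_bigr => k _; congr (_ *: _).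
    by have := hw k; rewrite /= mem_iota add0n ltn_ord => /(_ isT).
  by rewrite integral_cst//= mu_cyl// -EFinM mulrC.
pose C a := cyl (rcons s a).
pose N := cyl s `&` ~` (eps (size s) @^-1` [set 1] `|` eps (size s) @^-1` [set -1]).
have mN : measurable N by apply: measurableI => //; apply: measurableC; exact: measurableU.
have N0 : mu N = 0%E.
  apply: (@subset_measure0 _ _ _ mu _ (~` (eps (size s) @^-1` [set 1] `|` eps (size s) @^-1` [set
    -1]))) => //.
  - by apply: measurableC; exact: measurableU.
  - exact: subIsetr.
  - exact: mu_rest.
have sE : cyl s = (C 1 `|` C (-1)) `|` N.
  by rewrite /C !cyl_rcons /N -setIUr -setIUr setUv setIT.
have mC a : measurable (C a) by exact: cyl_measurable.
have mU : measurable (C 1 `|` C (-1)) by exact: measurableU.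
have D1 : [disjoint C 1 `|` C (-1) & N].
  by rewrite disj_set2E; apply/eqP; rewrite /C !cyl_rcons /N -setIUr setIACA setICr setI0.
have D2 : [disjoint C 1 & C (-1)].
  rewrite disj_set2E; apply/eqP/seteqP; split => // w [];
    rewrite /C !cyl_rcons => -[_ /= e1] [_ /= e2].
  have : (1 : R) = -1 := etrans (esym e1) e2.
  by move=> /eqP; rewrite -subr_eq0 opprK -mulr2n pnatr_eq0.
rewrite sE (ge0_integral_setU mu mU mN (mf _) (fun w _ => f0 w) D1).
rewrite (null_set_integral mN (mf _) N0) adde0.
rewrite (ge0_integral_setU mu (mC 1) (mC (-1)) (mf _) (fun w _ => f0 w) D2).
have sg a : a = 1 \/ a = -1 -> sgn (rcons s a).
  by move=> ha b; rewrite mem_rcons in_cons => /orP[/eqP ->//|]; exact: hs.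
have sz a : (size (rcons s a) + j)%N = m by rewrite size_rcons addSnnS.
rewrite !IH//; [|by apply: sg; right|by apply: sg; left].
have sum_rcons a : \sum_(k < size (rcons s a)) (rcons s a)`_k *: v k =
    \sum_(k < size s) s`_k *: v k + a *: v (size s).
  rewrite size_rcons big_ord_recr/= nth_rcons ltnn eqxx; congr (_ + _).
  by apply: eq_bigr => k _; rewrite nth_rcons ltn_ord.
rewrite -EFinD !sum_rcons !size_rcons scale1r scaleN1r /=; congr (_%:E).
by rewrite !exprS; ring.
Qed.

Lemma integral_rad (v : nat -> V) m :
  (\int[mu]_w (p (\sum_(k < m) eps k w *: v k) ^+ 2)%:E)%E =
  (rad [seq v k | k <- iota 0 m] (fun u => p u ^+ 2) 0)%:E.
Proof.
have := @integral_cyl v m m [::]; rewrite /= add0n expr0 mul1r big_ord0.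
have -> : cyl [::] = setT by apply/seteqP; split => // w _ k /=; rewrite in_nil.
by apply => // a; rewrite in_nil.
Qed.

End bernoulli_average.

Lemma additive_fun0 (V W : zmodType) (g : V -> W) :
  (forall v w, g (v + w) = g v + g w) -> g 0 = 0.
Proof. by move=> gD; apply: (addrI (g 0)); rewrite -gD !addr0. Qed.

(** * Reduction of the Banach space to a seminorm on real coordinates *)

Section real_structure.
Context {R : realType}.

Lemma rnorm_triangle s (E : normedModType (scalar_field R s)) (x y : E) :
  rnorm (x + y) <= rnorm x + rnorm y.
Proof.
case: s E x y => E x y; rewrite /rnorm /=; first exact: ler_normD.
have := ler_normD x y; rewrite lecE => /andP[_] /le_trans; apply.
by rewrite raddfD.
Qed.

Lemma rnormZ s (E : normedModType (scalar_field R s)) (a : R) (x : E) :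
  rnorm (to_scalar s a *: x) = `|a| * rnorm x.
Proof.
case: s E x => E x; rewrite /rnorm /=; first exact: normrZ.
rewrite normrZ normc_def/= expr0n addr0 sqrtr_sqr.
by case: `|x| => u w /=; rewrite mul0r subr0.
Qed.

(** Complex coordinates are split into real and imaginary parts, which doubles the dimension. *)
Lemma real_coordinates s (E : normedModType (scalar_field R s)) n : Vector.axiom n E ->
  exists d (psi : 'rV[R]_d -> E), [/\ (n <= d <= n.*2)%N,
    forall v w, psi (v + w) = psi v + psi w,
    forall a v, psi (a *: v) = to_scalar s a *: psi v &
    forall x, exists v, psi v = x].
Proof.
case: s E => E [f flin [g fK gK]].
- have gD v w : g (v + w) = g v + g w.
    by apply: (can_inj fK); have := flin 1 (g v) (g w); rewrite !scale1r !gK => ->.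
  have g0 := additive_fun0 gD.
  have gZ a v : g (a *: v) = a *: g v.
    by apply: (can_inj fK); have := flin a (g v) 0; rewrite !addr0 -g0 !gK addr0 => ->.
  by exists n, g; split => //; [rewrite leqnn -addnn leq_addr|move=> x; exists (f x)].
- have gD v w : g (v + w) = g v + g w.
    by apply: (can_inj fK); have := flin 1 (g v) (g w); rewrite !scale1r !gK => ->.
  have g0 := additive_fun0 gD.
  have gZ a v : g (a *: v) = a *: g v.
    by apply: (can_inj fK); have := flin a (g v) 0; rewrite !addr0 -g0 !gK addr0 => ->.
  pose h (v : 'rV[R]_(n + n)) : 'rV[R[i]]_n :=
    \row_j Complex (v 0 (lshift n j)) (v 0 (rshift n j)).
  exists (n + n)%N, (fun v => g (h v)); split.
  + by rewrite leq_addr addnn leqnn.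
  + by move=> v w; rewrite -gD; congr g; apply/rowP => j; rewrite !mxE.
  + move=> a v; rewrite -gZ; congr g; apply/rowP => j; rewrite !mxE /=.
    by congr Complex; rewrite mul0r ?subr0 ?addr0.
  + move=> x; exists (row_mx (\row_j complex.Re (f x 0 j)) (\row_j complex.Im (f x 0 j))).
    rewrite -[RHS]fK; congr g; apply/rowP => j; rewrite !mxE.
    rewrite (unsplitK (inl j)) (unsplitK (inr j)) /= !mxE.
    by case: (f x 0 j).
Qed.

End real_structure.

Section transfer.
Context {R : realType} {d : measure_display} {Omega : measurableType d}
  {mu : probability Omega R} (eps : nat -> {RV mu >-> R}).
Hypothesis beps : bernoulli_seq eps.
Context {s : scalar_kind} {E : normedModType (scalar_field R s)} {D : nat}
  (psi : 'rV[R]_D -> E).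
Hypotheses (psiD : forall v w, psi (v + w) = psi v + psi w)
  (psiZ : forall a v, psi (a *: v) = to_scalar s a *: psi v)
  (psiS : forall x, exists v, psi v = x).

Let p (v : 'rV[R]_D) : R := rnorm (psi v).
Let sqp : 'rV[R]_D -> R := fun v => p v ^+ 2.

Lemma seminorm_rnorm : seminorm p.
Proof.
split => [v w|a v]; rewrite /p ?psiD ?psiZ; [exact: rnorm_triangle|exact: rnormZ].
Qed.
Let sp := seminorm_rnorm.

Lemma feasibleP (v : nat -> 'rV[R]_D) m :
  ((\int[mu]_w ((rnorm (\sum_(k < m) to_scalar s (eps k w) *: psi (v k))) ^+ 2)%:E)
      `^ 2^-1 <= 1)%E <-> rad [seq v k | k <- iota 0 m] sqp 0 <= 1.
Proof.
have psi0 := additive_fun0 psiD.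
have -> : (fun w => ((rnorm (\sum_(k < m) to_scalar s (eps k w) *: psi (v k))) ^+ 2)%:E) =
    (fun w => (p (\sum_(k < m) eps k w *: v k) ^+ 2)%:E).
  apply/funext => w; rewrite /p; congr ((rnorm _ ^+ 2)%:E).
  elim: m => [|m IH]; first by rewrite !big_ord0 psi0.
  by rewrite !big_ord_recr/= psiD IH psiZ.
rewrite (integral_rad beps sp) poweR_EFin lee_fin.
set r := rad _ _ _.
have r0 : 0 <= r by apply: rad_ge0 => u; exact: sqr_ge0.
rewrite powR12_sqrt//; split => h.
  by rewrite -(sqr_sqrtr r0) -[leRHS](expr1n R 2) ler_sqr ?nnegrE ?sqrtr_ge0.
by rewrite -[leRHS]sqrtr1; apply: ler_wsqrtr.
Qed.

Lemma sum_rnorm_seq (v : nat -> 'rV[R]_D) m (q : R) :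
  \sum_(k < m) rnorm (psi (v k)) `^ q = \sum_(y <- [seq v k | k <- iota 0 m]) p y `^ q.
Proof.
rewrite big_map -(big_mkord xpredT (fun k => rnorm (psi (v k)) `^ q)).
by rewrite /index_iota subn0.
Qed.

Lemma lift_family m (x : 'I_m -> E) : exists v : nat -> 'rV[R]_D, x = (fun k : 'I_m => psi (v k)).
Proof.
have /choice [w hw] : forall k : 'I_m, exists v, psi v = x k by move=> k; exact: psiS.
exists (fun k => if insub k is Some i then w i else 0); apply/funext => k.
by rewrite valK hw.
Qed.

(** Padding by zeros turns a family of fewer than [m] vectors into one admissible for the supremum
    over [m] vectors. *)
Lemma rad_cat_nseq0 k xs z : rad (xs ++ nseq k 0) sqp z = rad xs sqp z.
Proof.
elim: xs z => [|x xs IH] z /=; last by rewrite !IH.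
elim: k z => //= k IH z; rewrite subr0 addr0 !IH; by field.
Qed.

Variables (q K : R) (m : nat).
Hypotheses (q2 : 2 < q) (K0 : 0 <= K)
  (hK : (cotype_norm_on eps (idfun : {linear E -> E}) q m <= K%:E)%E).

(** The scale [a] is left free because normalising by the Rademacher mean is impossible when that
    mean is zero. *)
Lemma cotype_scaled ys (a : R) : (size ys <= m)%N -> 0 <= a -> a ^+ 2 * rad ys sqp 0 <= 1 ->
  a `^ q * \sum_(y <- ys) p y `^ q <= K `^ q.
Proof.
move=> sy a0 ha; have q0 : 0 < q by apply: lt_trans q2.
pose v k := a *: nth 0 ys k.
have vE : [seq v k | k <- iota 0 m] = [seq a *: y | y <- ys ++ nseq (m - size ys) 0].
  rewrite /v (map_comp (fun y => a *: y) (nth 0 ys)); congr map.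
  apply: (@eq_from_nth _ 0); first by rewrite size_map size_iota size_cat size_nseq subnKC.
  move=> i; rewrite size_map size_iota => im.
  rewrite (nth_map 0%N) ?size_iota// nth_iota// add0n nth_cat; case: ltnP => // si.
  by rewrite nth_default// nth_nseq if_same.
have fv : rad [seq v k | k <- iota 0 m] sqp 0 <= 1.
  have := rad_scale sp a (ys ++ nseq (m - size ys) 0) 0.
  by rewrite vE scaler0 => ->; rewrite rad_cat_nseq0.
have hle : (((\sum_(k < m) rnorm (psi (v k)) `^ q) `^ q^-1)%R%:E <= K%:E)%E.
  apply: le_trans hK; apply: ereal_sup_ubound.
  by exists (fun k : 'I_m => psi (v k)) => //; apply/feasibleP.
move: hle; rewrite lee_fin sum_rnorm_seq vE.
have -> : \sum_(y <- [seq a *: y | y <- ys ++ nseq (m - size ys) 0]) p y `^ q =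
    a `^ q * \sum_(y <- ys) p y `^ q.
  rewrite big_map big_cat/= [X in _ + X]big1_seq ?addr0; last first.
    move=> y /andP[_ /nseqP[-> _]]; rewrite scaler0 (semi0 sp) powR0 ?lt0r_neq0//.
  rewrite mulr_sumr; apply: eq_bigr => y _.
  by rewrite sp.2 powRM ?(semi_ge0 sp)// ger0_norm.
set S := a `^ q * _ => hS.
have S0 : 0 <= S by rewrite mulr_ge0 ?powR_ge0// sumr_ge0// => y _; exact: powR_ge0.
have -> : S = (S `^ q^-1) `^ q by rewrite -powRrM mulVf ?lt0r_neq0// powRr1.
by apply: ge0_ler_powR; rewrite ?nnegrE ?powR_ge0// ltW.
Qed.

Lemma cotype_few_vectors ys : (size ys <= m)%N ->
  \sum_(y <- ys) p y `^ q <= K `^ q * (rad ys sqp 0) `^ (q / 2).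
Proof.
move=> sy; have q0 : 0 < q by apply: lt_trans q2.
set r := rad ys sqp 0; set S := \sum_(_ <- _) _.
have r0 : 0 <= r by apply: rad_ge0 => u; exact: sqr_ge0.
have S0 : 0 <= S by rewrite sumr_ge0// => y _; exact: powR_ge0.
have [rz|rn0] := eqVneq r 0.
  rewrite rz powR0 ?mulr0; last by rewrite mulf_neq0// lt0r_neq0.
  rewrite leNgt; apply/negP => Sp.
  have Kq : 0 <= K `^ q by exact: powR_ge0.
  (* With zero Rademacher mean every scale is admissible; this one would give K^q + 1 <= K^q. *)
  have := @cotype_scaled ys (((K `^ q + 1) / S) `^ q^-1) sy (powR_ge0 _ _).
  rewrite -/r rz mulr0 ler01 => /(_ isT).
  rewrite -powRrM mulVf ?lt0r_neq0// powRr1; last by rewrite divr_ge0// addr_ge0.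
  by rewrite -/S divfK ?lt0r_neq0//; lra.
have rp : 0 < r by rewrite lt0r rn0.
have := @cotype_scaled ys (Num.sqrt r)^-1 sy.
rewrite invr_ge0 sqrtr_ge0 -/r exprVn sqr_sqrtr// mulVf// lexx -/S => /(_ isT isT).
have -> : (Num.sqrt r)^-1 `^ q = (r `^ (q / 2))^-1.
  have -> : (Num.sqrt r)^-1 = r `^ (- 2^-1) by rewrite powRN powR12_sqrt.
  by rewrite -powRrM -powRN; congr (_ `^ _); field.
by rewrite ler_pdivrMl ?powR_gt0// mulrC.
Qed.

End transfer.

(** The 4 in the constant makes [B], hence [X], at least 4, which leaves room for rounding and for d
    <= 2n; the [8 * c] absorbs the 2 in 1 + ln d <= 2 L and the 4 in the bound 4 / B of the
    power. *)
Lemma few_vectors_count (R : realType) (c q : R) (n d : nat) : 0 <= c -> 2 < q -> (0 < n)%N ->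
  (n <= d <= n.*2)%N ->
  exists m : nat, [/\ (d <= m)%N,
    m%:R <= n%:R * ((4 + 8 * c) * (1 + ln n%:R)) `^ (1 / (1 - 2 / q)) &
    c * (1 + ln d%:R) * (d%:R / m%:R) `^ (1 - 2 / q) <= 3].
Proof.
move=> c0 q2 n0 /andP[nd dn].
have q0 : 0 < q by apply: lt_trans q2.
set L := 1 + ln (n%:R : R); set B := (4 + 8 * c) * L; set u := 1 - 2 / q.
have u0 : 0 < u by rewrite subr_gt0 ltr_pdivrMr// mul1r.
have u1 : u <= 1 by rewrite gerBl divr_ge0// ltW.
have nR : 0 < n%:R :> R by rewrite ltr0n.
have L1 : 1 <= L by rewrite lerDl ln_nat_ge0.
have B4 : 4 <= B by rewrite /B; nra.
have B1 : 1 <= B by lra.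
have B0 : 0 < B by lra.
set X := B `^ (1 / u).
have BX : B <= X.
  rewrite -[leLHS]powRr1 ?(ltW B0)//; apply: ler_powR => //.
  by rewrite div1r invf_ge1.
have X4 : 4 <= X by apply: le_trans BX.
have n1 : 1 <= n%:R :> R by rewrite ler1n.
have nX0 : 0 <= n%:R * X by rewrite mulr_ge0// ltW//; lra.
(* As n X >= 4, rounding down loses at most a factor 2, so m >= n X / 2 >= 2n >= d. *)
pose m := Num.truncn (n%:R * X).
have /andP[m1 m2] : m%:R <= n%:R * X < m.+1%:R by rewrite truncn_itv.
have m3 : n%:R * X <= 2 * m%:R.
  have : n%:R * X < m%:R + 1 by rewrite natr1.
  by nra.
have dR : d%:R <= 2 * n%:R :> R by rewrite -natrM ler_nat mul2n.
have d0 : 0 < d%:R :> R by apply: lt_le_trans nR _; rewrite ler_nat.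
exists m; split => //.
  by rewrite -(ler_nat R); nra.
have m0 : 0 < m%:R :> R by nra.
have lnd : 1 + ln (d%:R : R) <= 2 * L.
  have : ln (d%:R : R) <= ln (2 * n%:R) by rewrite ler_ln ?posrE// mulr_gt0.
  rewrite lnM ?posrE//.
  have : ln (2 : R) <= 1 by have := @le_ln1Dx R 1; rewrite -[1 + 1]/(2); apply; lra.
  by have := ln_nat_ge0 (R := R) n; rewrite /L; lra.
have dm : d%:R / m%:R <= 4 / X.
  rewrite ler_pdivrMr// mulrAC ler_pdivlMr; last lra.
  by nra.
(* Here X^u = B, and 4^u <= 4 because u <= 1. *)
have hpow : (d%:R / m%:R) `^ u <= 4 / B.
  apply: (@le_trans _ _ ((4 / X) `^ u)).
    apply: ge0_ler_powR; rewrite ?nnegrE ?divr_ge0 ?(ltW u0) ?(ltW m0) ?(ltW d0)//; lra.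
  rewrite powRM ?invr_ge0//; last lra.
  have -> : X^-1 `^ u = B^-1.
    rewrite -powR_inv1 ?powR_ge0// -!powRrM div1r mulN1r mulrN mulVf ?lt0r_neq0//.
    by rewrite powR_inv1// ltW.
  rewrite ler_pM2r ?invr_gt0//.
  by apply: ler1_powR => //; lra.
apply: (@le_trans _ _ (c * (2 * L) * (4 / B))).
  apply: ler_pM => //; first by rewrite mulr_ge0// addr_ge0// ln_nat_ge0.
  exact: ler_wpM2l.
have -> : c * (2 * L) * (4 / B) = 8 * c * L / B by ring.
by rewrite ler_pdivrMr// /B; nra.
Qed.

Theorem theorem3 (R : realType) :
  exists2 c0 : R, 0 < c0 &
  forall (d : measure_display) (Omega : measurableType d)
    (mu : probability Omega R) (eps : nat -> {RV mu >-> R}),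
  bernoulli_seq eps ->
  forall (q : R), 2 < q ->
  forall (n : nat), (0 < n)%N ->
  forall (s : scalar_kind) (E : completeNormedModType (scalar_field R s)),
  Vector.axiom n E ->
  exists m : nat,
    [/\ (0 < m)%N,
        m%:R <= n%:R * (c0 * (1 + ln n%:R)) `^ (1 / (1 - 2 / q)) &
        (cotype_norm eps (idfun : {linear E -> E}) q
         <= 2%:E * cotype_norm_on eps (idfun : {linear E -> E}) q m)%E].
Proof.
have C0 := @cotype_cst_ge0 R.
exists (4 + 8 * cotype_cst); first by rewrite ltr_pwDl// mulr_ge0.
move=> d Omega mu eps beps q q2 n n0 s E /real_coordinates [D [psi [nD psiD psiZ psiS]]].
have [m [Dm mle hm]] := few_vectors_count C0 q2 n0 nD.
have D0 : (0 < D)%N by move: nD => /andP[nD _]; exact: leq_trans nD.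
have q0 : 0 < q by apply: lt_trans q2.
exists m; split => //; first exact: leq_trans Dm.
pose p (v : 'rV[R]_D) : R := rnorm (psi v).
have sp : seminorm p := seminorm_rnorm psiD psiZ.
set Cm := cotype_norm_on eps _ q m.
(* The zero family is admissible, which excludes the value [-oo]; the value [+oo] makes the claim
   trivial. *)
have Cm0 : (0 <= Cm)%E.
  have h0 := @feasibleP R d Omega mu eps beps s E D psi psiD psiZ (fun=> 0) m.
  apply: (@le_trans _ _ (((\sum_(k < m) rnorm (psi 0) `^ q) `^ q^-1)%R%:E)).
    by rewrite lee_fin powR_ge0.
  apply: ereal_sup_ubound; exists (fun=> psi 0) => //; apply/h0.
  have z0 k a : [seq (0 : 'rV[R]_D) | _ <- iota a k] = nseq k 0.
    by elim: k a => //= k IH a; rewrite IH.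
  rewrite z0 -[nseq m 0]cat0s (rad_cat_nseq0 psi) /= (_ : rnorm (psi 0) = p 0)// (semi0 sp).
  by rewrite expr0n ler01.
case CmE : Cm Cm0 => [K| |] // Cm0; last by rewrite gt0_muley ?leey// lte_fin.
have K0 : 0 <= K by rewrite -lee_fin.
have hK ys := @cotype_few_vectors R d Omega mu eps beps s E D psi psiD psiZ q K m q2 K0
  (eq_ind_r (fun z => (z <= _)%E) (lexx _) CmE) ys.
apply: ub_ereal_sup => _ [N _ <-]; apply: ub_ereal_sup => _ [x hx <-].
have [v xE] := lift_family psiS x; rewrite xE in hx *.
have /(feasibleP beps psiD psiZ) hr := hx.
rewrite -EFinM lee_fin.
rewrite (_ : \sum_(k < N) _ = \sum_(k < N) rnorm (psi (v k)) `^ q)// (sum_rnorm_seq psi v N q).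
have hS := cotype_from_few sp D0 q2 K0 Dm hK hm hr.
have h4 : 4 * K `^ q <= (2 * K) `^ q.
  rewrite powRM// ler_wpM2r ?powR_ge0//.
  have -> : 4 = 2 `^ 2 :> R by rewrite powR_mulrn//; ring.
  by apply: ler_powR; rewrite ?ler1n// ltW.
have {h4}hS := le_trans hS h4.
have -> : 2 * K = ((2 * K) `^ q) `^ q^-1.
  by rewrite -powRrM mulfV ?lt0r_neq0// powRr1// mulr_ge0.
apply: ge0_ler_powR; rewrite ?nnegrE ?powR_ge0 ?invr_ge0 ?(ltW q0)//.
by apply: sumr_ge0 => y _; exact: powR_ge0.
Qed.
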